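(* Timeline Partial Dominating Set can be solved in $2^{\mathcal{O}(t)}\cdot (n+T)^{\mathcal{O}(1)}$ time, where $n=|V|$.
   Context: A temporal graph $\mathcal{G}=(G_1,\dots,G_T)$ is a finite sequence of simple undirected graphs (snapshots) on a common finite vertex set $V$, $n=|V|$. A temporal vertex is a pair $(v,i)$. An activity interval is a triple $(v,a,b)$ with $v\in V$, $1\le a\le b\le T$; its length is $b-a$. A $k$-activity $\ell$-timeline is a set of activity intervals with at most $k$ intervals per vertex, each of length at most $\ell$. A vertex $v$ is active at time $i$ if some $(v,a,b)$ in the timeline has $a\le i\le b$; the timeline dominates $(v,i)$ if $v\in N_{G_i}[u]$ for some $u$ active at time $i$. Timeline Partial Dominating Set: given $\mathcal{G}$ and integers $k\ge1,\ell\ge0,t\ge0$, decide whether some $k$-activity $\ell$-timeline dominates at least $t$ temporal vertices. *)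

(* Defs.v *)
From mathcomp Require Import all_boot.

Set Implicit Arguments.
Unset Strict Implicit.
Unset Printing Implicit Defensive.

Record sgraph (V : finType) := SGraph {
  adj : rel V;
  adj_sym : symmetric adj;
  adj_irrefl : irreflexive adj
}.

Definition closed_nbh (V : finType) (g : sgraph V) (u : V) : {set V} :=
  [set v | (v == u) || adj g u v].

(* The times 1, ..., T are numbered 0, ..., T - 1 here. *)
Definition temporal_graph (V : finType) (T : nat) := T.-tuple (sgraph V).

Section Timelines.

Variables (V : finType) (T : nat).

(* ((v, a), b) stands for (v, a, b); that a <= b holds is part of
   [is_timeline]. *)
Local Notation interval := (V * 'I_T * 'I_T)%type.

Definition ivertex (x : interval) : V := x.1.1.
Definition istart (x : interval) : 'I_T := x.1.2.
Definition iend (x : interval) : 'I_T := x.2.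

Definition is_timeline (k l : nat) (S : {set interval}) : bool :=
  [forall x in S, (istart x <= iend x) && (iend x - istart x <= l)] &&
  [forall v : V, #|[set x in S | ivertex x == v]| <= k].

Definition active (S : {set interval}) (v : V) (i : 'I_T) : bool :=
  [exists x in S, [&& ivertex x == v, istart x <= i & i <= iend x]].

Definition dominates (G : temporal_graph V T) (S : {set interval})
    (v : V) (i : 'I_T) : bool :=
  [exists u : V, active S u i && (v \in closed_nbh (tnth G i) u)].

Definition dominated (G : temporal_graph V T) (S : {set interval}) :
    {set V * 'I_T} :=
  [set p | dominates G S p.1 p.2].

Definition timeline_partial_dominating_set (G : temporal_graph V T)
    (k l t : nat) : bool :=
  [exists S : {set interval},
     is_timeline k l S && (t <= #|dominated G S|)].

(* Vertices are numbered in the order of [enum V]; the entry for the pair of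
   vertices numbered u, v at time i (all from 0) is at position
   5 + (i * #|V| + u) * #|V| + v. *)
Definition encode (G : temporal_graph V T) (k l t : nat) : seq nat :=
  [:: #|V|; T; k; l; t] ++
  flatten [seq [seq (adj g u v : nat) | u <- enum V, v <- enum V]
          | g <- val G].

End Timelines.

(* A random access machine with unit-cost instructions: registers R[0], R[1],
   ... hold natural numbers and are 0 initially; the input is a read-only array
   of natural numbers.  The arithmetic is addition and truncated subtraction
   only: unit-cost multiplication would make the model unreasonably strong. *)
Inductive instr :=
| Const of nat & nat        (* Const x c   : R[x] := c           *)
| Add of nat & nat & nat    (* Add x y z   : R[x] := R[y] + R[z] *)
| Sub of nat & nat & nat    (* Sub x y z   : R[x] := R[y] - R[z] *)
| Fetch of nat & nat        (* Fetch x y   : R[x] := R[R[y]]     *)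
| Store of nat & nat        (* Store x y   : R[R[x]] := R[y]     *)
| Read of nat & nat         (* Read x y    : R[x] := input[R[y]], 0 past the end *)
| Jumpz of nat & nat        (* Jumpz x p   : if R[x] = 0, go to instruction p *)
| Accept
| Reject.

Definition program := seq instr.

Definition memory := nat -> nat.

Definition upd (R : memory) (x a : nat) : memory :=
  fun y => if y == x then a else R y.

(* [exec P input s pc R] is [Some b] when P, started at instruction pc with
   register contents R, halts with answer b after executing at most s
   instructions.  Leaving the program text gives no answer. *)
Fixpoint exec (P : program) (input : seq nat) (s pc : nat) (R : memory) :
    option bool :=
  if s isn't s'.+1 then None else
  match onth P pc with
  | None => None
  | Some (Const x c) => exec P input s' pc.+1 (upd R x c)
  | Some (Add x y z) => exec P input s' pc.+1 (upd R x (R y + R z))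
  | Some (Sub x y z) => exec P input s' pc.+1 (upd R x (R y - R z))
  | Some (Fetch x y) => exec P input s' pc.+1 (upd R x (R (R y)))
  | Some (Store x y) => exec P input s' pc.+1 (upd R (R x) (R y))
  | Some (Read x y) => exec P input s' pc.+1 (upd R x (nth 0 input (R y)))
  | Some (Jumpz x p) => exec P input s' (if R x == 0 then p else pc.+1) R
  | Some Accept => Some true
  | Some Reject => Some false
  end.

Definition answers_within (P : program) (input : seq nat) (s : nat)
    (b : bool) : Prop :=
  exec P input s 0 (fun _ => 0) = Some b.

(* Main.v *)
Require Import Defs.
From mathcomp Require Import all_boot zify.

(* Put L = l + 1 and K = k L.  Left to itself, a vertex can be active for
   min(K, T) time steps and dominates itself then, so the answer is yes when
   t <= n min(K, T), and no when t > n T.  Otherwise n K < t.  Give every vertex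
   K units of fuel, one unit being burnt per active time step: when L divides
   the remaining fuel the vertex may rest or start a new interval, otherwise it
   is in the middle of an interval and has to stay active.  There are
   (K + 1)^n <= 2^(n K) <= 2^t fuel vectors, so a dynamic program over time,
   whose states are the fuel vectors read as numbers in base K + 1, is fast
   enough. *)

Set Implicit Arguments.
Unset Strict Implicit.
Unset Printing Implicit Defensive.

(** * A loop language *)

(** Fuel loses nothing: domination is monotone in activity, so intervals may be prolonged to full
    length and cut off only at the end of time, and an interval that would overlap the one in
    progress can wait until that one is over. One number per vertex then replaces a set of
    intervals. The obstacle is the running time. The machine only adds and subtracts, so products,
    powers and divisions become counting loops, while k and l may be huge compared with n, T and
    2^t. Hence k and l are cut down to at most T, and t to at most n T + 1, before anything is
    multiplied; in the case where the dynamic program decides, K < T shows that k and l were not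
    changed. Capping the loops turns the time bound into a structural induction that knows nothing
    about values. It also saves a case distinction: the dynamic program is run in every case, and if
    it has too many states, its loops are cut short and the result does no harm. In the final cap,
    (n + T + 1)^2 covers n, T and n T + 1, and 2^t covers the number of states. *)

Inductive expr :=
| Lit of nat
| Var of nat
| Plus of expr & expr
| Minus of expr & expr
| Input of expr
| Entry of expr.

Inductive cmd :=
| Assign of nat & expr
| Put of expr & expr
| Seq of cmd & cmd
| Loop of expr & cmd.

Record state := State { var : nat -> nat; tab : nat -> nat }.

Definition override (g : nat -> nat) (x a : nat) : nat -> nat :=
  fun y => if eqn y x then a else g y.

Section Semantics.

Variable inp : seq nat.

Fixpoint eval (s : state) (e : expr) : nat :=
  match e with
  | Lit a => a
  | Var x => var s x
  | Plus e1 e2 => eval s e1 + eval s e2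
  | Minus e1 e2 => eval s e1 - eval s e2
  | Input e1 => nth 0 inp (eval s e1)
  | Entry e1 => tab s (eval s e1)
  end.

(* Variable 0 caps the number of rounds of every loop, so that the running
   time of a command that does not assign it is polynomial in its value.  The
   cap is raised to (n + T + 1)^2 2^t before the dynamic program starts. *)
Definition capped (e : expr) : expr := Minus e (Minus e (Var 0)).

Fixpoint sem (c : cmd) (s : state) : state :=
  match c with
  | Assign x e => State (override (var s) x (eval s e)) (tab s)
  | Put a e => State (var s) (override (tab s) (eval s a) (eval s e))
  | Seq c1 c2 => sem c2 (sem c1 s)
  | Loop e c1 => iter (eval s (capped e)) (sem c1) s
  end.

End Semantics.

(** * Compilation *)

(* Variable x lives in register 3x, table entry a in register 3a + 1, and the
   temporary j in register 3j + 2. *)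
Definition tmp (j : nat) : nat := 3 * j + 2.

(** Turns a table index a, held in [tmp d], into the register number 3 a + 1 by additions alone. *)
Definition table_address (d : nat) : program :=
  [:: Add (tmp d.+1) (tmp d) (tmp d); Add (tmp d) (tmp d) (tmp d.+1);
      Const (tmp d.+1) 1; Add (tmp d) (tmp d) (tmp d.+1)].

(** The depth [d] acts as a stack height: the value is left in [tmp d], and the temporaries below it
    survive. Adding a zeroed register serves as a move instruction. *)
Fixpoint compile_expr (e : expr) (d : nat) : program :=
  match e with
  | Lit a => [:: Const (tmp d) a]
  | Var x => [:: Const (tmp d) 0; Add (tmp d) (tmp d) (3 * x)]
  | Plus e1 e2 =>
      compile_expr e1 d ++ compile_expr e2 d.+1 ++ [:: Add (tmp d) (tmp d) (tmp
        d.+1)]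
  | Minus e1 e2 =>
      compile_expr e1 d ++ compile_expr e2 d.+1 ++ [:: Defs.Sub (tmp d) (tmp d)
        (tmp d.+1)]
  | Input e1 => compile_expr e1 d ++ [:: Read (tmp d) (tmp d)]
  | Entry e1 => compile_expr e1 d ++ table_address d ++ [:: Fetch (tmp d) (tmp
    d)]
  end.

(** The start address [pc] is a parameter because jump targets are absolute. The counter of a loop
    stays in [tmp d] while the body runs, so the body is compiled at depth [d.+1]. Jumping back
    unconditionally is a test of a register just set to 0. *)
Fixpoint compile (c : cmd) (d pc : nat) : program :=
  match c with
  | Assign x e =>
      compile_expr e d ++
      [:: Const (tmp d.+1) 0; Add (3 * x) (tmp d) (tmp d.+1)]
  | Put a e =>
      compile_expr a d ++ table_address d ++ compile_expr e d.+1 ++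
      [:: Store (tmp d) (tmp d.+1)]
  | Seq c1 c2 =>
      let code1 := compile c1 d pc in code1 ++ compile c2 d (pc + size code1)
  | Loop e c1 =>
      let head := compile_expr (capped e) d in
      let body := compile c1 d.+1 (pc + size head + 3) in
      head ++
      [:: Jumpz (tmp d) (pc + size head + size body + 5);
          Const (tmp d.+1) 1; Defs.Sub (tmp d) (tmp d) (tmp d.+1)] ++
      body ++ [:: Const (tmp d.+1) 0; Jumpz (tmp d.+1) (pc + size head)]
  end.

Section Correctness.

Variable inp : seq nat.

Definition straight (i : instr) : bool :=
  match i with Jumpz _ _ | Accept | Reject => false | _ => true end.

Definition run1 (R : memory) (i : instr) : memory :=
  match i with
  | Const x c => upd R x c
  | Add x y z => upd R x (R y + R z)
  | Defs.Sub x y z => upd R x (R y - R z)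
  | Fetch x y => upd R x (R (R y))
  | Store x y => upd R (R x) (R y)
  | Read x y => upd R x (nth 0 inp (R y))
  | _ => R
  end.

Definition run (code : program) (R : memory) : memory := foldl run1 R code.

Lemma run_cat (c1 c2 : program) (R : memory) :
  run (c1 ++ c2) R = run c2 (run c1 R).
Proof. exact: foldl_cat. Qed.

Lemma onth_mid (T : Type) (pre post : seq T) (x : T) :
  onth (pre ++ x :: post) (size pre) = Some x.
Proof. by elim: pre => //=. Qed.

Lemma exec_straight (P pre code post : program) (pc fuel : nat) (R : memory) :
  P = pre ++ code ++ post -> pc = size pre -> all straight code ->
  exec P inp (size code + fuel) pc R =
  exec P inp fuel (pc + size code) (run code R).
Proof.
elim: code pre pc R => [|i code IH] pre pc R eqP eqpc.
  by rewrite /= addn0.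
case/andP=> si sc.
have Pi : onth P pc = Some i by rewrite eqP eqpc onth_mid.
have := IH (rcons pre i) pc.+1 (run1 R i).
rewrite cat_rcons size_rcons eqpc => /(_ eqP erefl sc).
rewrite -eqpc addSnnS.
by case: i si {IH eqP} Pi => //= [a b|a b c|a b c|a b|a b|a b] _ -> //=.
Qed.

Lemma exec_jumpz (P : program) (fuel pc x p : nat) (R : memory) :
  onth P pc = Some (Jumpz x p) ->
  exec P inp fuel.+1 pc R = exec P inp fuel (if R x == 0 then p else pc.+1) R.
Proof. by move=> /= ->. Qed.

Definition agree (s : state) (R : memory) : Prop :=
  (forall x, R (3 * x) = var s x) /\ (forall a, R (3 * a + 1) = tab s a).

Definition frame (d : nat) (R R' : memory) : Prop :=
  forall a, (forall j, d <= j -> a <> tmp j) -> R' a = R a.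

Lemma frame_trans (d : nat) (R1 R2 R3 : memory) :
  frame d R1 R2 -> frame d R2 R3 -> frame d R1 R3.
Proof. by move=> h12 h23 a ha; rewrite h23 // h12. Qed.

Lemma frameW (d d' : nat) (R R' : memory) :
  d <= d' -> frame d' R R' -> frame d R R'.
Proof. by move=> dd' h a ha; apply: h => j /(leq_trans dd')/ha. Qed.

Lemma frame_upd (d j a : nat) (R : memory) :
  d <= j -> frame d R (upd R (tmp j) a).
Proof. by move=> dj b hb; rewrite /upd; case: eqP => // /hb; case. Qed.

Lemma frame_tmp (d j : nat) (R R' : memory) :
  frame d R R' -> j < d -> R' (tmp j) = R (tmp j).
Proof. by move=> h jd; apply: h => i; rewrite /tmp; lia. Qed.

Lemma agree_frame (d : nat) (s : state) (R R' : memory) :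
  agree s R -> frame d R R' -> agree s R'.
Proof.
move=> [hv ht] fr; split=> a.
  by rewrite -hv; apply: fr => j; rewrite /tmp; lia.
by rewrite -ht; apply: fr => j; rewrite /tmp; lia.
Qed.

Lemma upd_eq (R : memory) (x a : nat) : upd R x a x = a.
Proof. by rewrite /upd eqxx. Qed.

Lemma upd_neq (R : memory) (x y a : nat) : y != x -> upd R x a y = R y.
Proof. by rewrite /upd => /negbTE ->. Qed.

Lemma tmp_eq (i j : nat) : (tmp i == tmp j) = (i == j).
Proof. by rewrite /tmp; lia. Qed.

Lemma run_table_address (d : nat) (R : memory) :
  run (table_address d) R (tmp d) = 3 * R (tmp d) + 1 /\
  frame d R (run (table_address d) R).
Proof.
split.
  rewrite /= !upd_eq (@upd_neq _ (tmp d.+1) (tmp d)) ?upd_eq ?tmp_eq;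
    last by lia.
  rewrite (@upd_neq _ (tmp d.+1) (tmp d)) ?upd_eq ?tmp_eq; last by lia.
  by rewrite ?upd_eq; lia.
by rewrite /=; do 4 (apply: frame_trans; last by apply: frame_upd; lia).
Qed.

Lemma straight_compile_expr (e : expr) (d : nat) : all straight (compile_expr e
  d).
Proof.
elim: e d => //= [e1 IH1 e2 IH2|e1 IH1 e2 IH2|e1 IH1|e1 IH1] d;
  by rewrite !all_cat /= IH1 ?IH2.
Qed.

Lemma run_compile_expr (e : expr) (d : nat) (s : state) (R : memory) :
  agree s R ->
  run (compile_expr e d) R (tmp d) = eval inp s e /\
  frame d R (run (compile_expr e d) R).
Proof.
elim: e d R => [a|x|e1 IH1 e2 IH2|e1 IH1 e2 IH2|e1 IH1|e1 IH1] d R ag /=.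
- by rewrite upd_eq; split=> //; apply: frame_upd.
- rewrite !upd_eq add0n upd_neq; last by rewrite /tmp; lia.
  split; first by case: ag.
  by do 2 (apply: frame_trans; last exact: frame_upd).
- rewrite !run_cat /=; have [v1 f1] := IH1 d R ag.
  have [v2 f2] := IH2 d.+1 _ (agree_frame ag f1).
  rewrite upd_eq v2 (frame_tmp f2) // v1; split=> //.
  apply: frame_trans; last exact: frame_upd.
  by apply: frame_trans f1 _; apply: frameW f2.
- rewrite !run_cat /=; have [v1 f1] := IH1 d R ag.
  have [v2 f2] := IH2 d.+1 _ (agree_frame ag f1).
  rewrite upd_eq v2 (frame_tmp f2) // v1; split=> //.
  apply: frame_trans; last exact: frame_upd.
  by apply: frame_trans f1 _; apply: frameW f2.
- rewrite !run_cat /=; have [v1 f1] := IH1 d R ag.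
  rewrite upd_eq v1; split=> //.
  by apply: frame_trans f1 _; apply: frame_upd.
- have [v1 f1] := IH1 d R ag.
  rewrite run_cat -[_ :: _]/(table_address d ++ [:: Fetch (tmp d) (tmp d)]).
  rewrite run_cat; set R1 := run _ R in v1 f1 *.
  have [v2 f2] := run_table_address d R1; set R2 := run _ R1 in v2 f2 *.
  have fr : frame d R R2 by apply: frame_trans f2.
  rewrite /= upd_eq v2 v1; split; first by case: (agree_frame ag fr).
  by apply: frame_trans fr _; apply: frame_upd.
Qed.

(** The exact number of executed instructions. A round of a loop costs 5 besides its body: the test,
    two instructions to decrement the counter and two to jump back; the extra 1 is the test that
    leaves the loop. Depth 0 is as good as any, since the size of the code of an expression does not
    depend on the depth. *)
Fixpoint cost (c : cmd) (s : state) : nat :=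
  match c with
  | Assign x e => size (compile_expr e 0) + 2
  | Put a e => size (compile_expr a 0) + 4 + size (compile_expr e 0) + 1
  | Seq c1 c2 => cost c1 s + cost c2 (sem inp c1 s)
  | Loop e c1 =>
      size (compile_expr (capped e) 0) + 1 +
      \sum_(j < eval inp s (capped e)) (5 + cost c1 (iter j (sem inp c1) s))
  end.

Lemma size_compile_expr (e : expr) (d : nat) :
  size (compile_expr e d) = size (compile_expr e 0).
Proof.
elim: e d => //= [e1 IH1 e2 IH2|e1 IH1 e2 IH2|e1 IH1|e1 IH1] d;
  by rewrite !size_cat /= ?(IH1 d) ?(IH2 d.+1) ?(IH2 1).
Qed.

(** The surrounding code [pre] and [post] is arbitrary so that the induction can descend into
    subcommands of a fixed program with absolute jumps. The clause on temporaries below [d] protects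
    the counters of the enclosing loops. *)
Lemma compile_correct (c : cmd) (P pre post : program) (d pc : nat) (s : state)
    (R : memory) :
  P = pre ++ compile c d pc ++ post -> pc = size pre -> agree s R ->
  exists R', [/\ agree (sem inp c s) R',
    forall j, j < d -> R' (tmp j) = R (tmp j) &
    forall fuel, exec P inp (cost c s + fuel) pc R =
      exec P inp fuel (pc + size (compile c d pc)) R'].
Proof.
elim: c pre post d pc s R
  => [x e|a e|c1 IH1 c2 IH2|e c1 IH1] pre post d pc s R eqP eqpc ag.
- exists (run (compile (Assign x e) d pc) R); split; last first.
  + move=> fuel; rewrite -(exec_straight _ _ eqP eqpc).
      by rewrite /= size_cat (size_compile_expr e d).
    by rewrite /= all_cat straight_compile_expr.
  + move=> j jd; rewrite /= run_cat; have [_ fr] := run_compile_expr e d ag.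
    rewrite /= !upd_neq ?(frame_tmp fr) //; rewrite /tmp; lia.
  have [v fr] := run_compile_expr e d ag.
  rewrite /= run_cat; set R1 := run _ R in v fr *.
  have [hv ht] := agree_frame ag fr.
  rewrite /= upd_eq addn0 upd_neq ?tmp_eq; last by lia.
  rewrite v; split=> y /=.
    rewrite /override; case: (@eqnP y x) => [->|ne]; first by rewrite upd_eq.
    by rewrite !upd_neq //; rewrite /tmp; lia.
  by rewrite !upd_neq //; rewrite /tmp; lia.
- exists (run (compile (Put a e) d pc) R).
  have [v fr] := run_compile_expr a d ag.
  have [v' fr'] := run_table_address d (run (compile_expr a d) R).
  have fr2 := frame_trans fr fr'.
  have [v2 f2] := run_compile_expr e d.+1 (agree_frame ag fr2).
  have fr3 := frame_trans fr2 (frameW (leqnSn d) f2).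
  have [hv ht] := agree_frame ag fr3.
  have eqr : run (compile (Put a e) d pc) R =
      run [:: Store (tmp d) (tmp d.+1)] (run (compile_expr e d.+1)
        (run (table_address d) (run (compile_expr a d) R))).
    by rewrite /compile !run_cat.
  rewrite eqr; set R3 := run (compile_expr e d.+1) _ in v2 f2 fr3 hv ht *.
  have vd : R3 (tmp d) = 3 * eval inp s a + 1.
    by rewrite (frame_tmp f2) // v' v.
  split; last first.
  + move=> fuel; rewrite -eqr -(exec_straight _ _ eqP eqpc).
      rewrite /compile !size_cat (size_compile_expr a d) (size_compile_expr e
        d.+1).
      by congr (exec P inp _ pc R) => /=; lia.
    by rewrite /compile !all_cat !straight_compile_expr.
  + move=> j jd; rewrite /= vd upd_neq ?(frame_tmp fr3) //.
    by rewrite /tmp; lia.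
  rewrite /= vd v2; split=> y /=.
    by rewrite upd_neq //; lia.
  rewrite /override; case: (@eqnP y (eval inp s a)) => [->|ne].
    by rewrite upd_eq.
  by rewrite upd_neq //; lia.
- have eqP1 : P = pre ++ compile c1 d pc ++ (compile c2 d (pc + size (compile
    c1 d pc)) ++ post).
    by rewrite eqP /= !catA.
  have [R1 [ag1 k1 e1]] := IH1 _ _ _ _ _ _ eqP1 eqpc ag.
  have eqP2 : P = (pre ++ compile c1 d pc) ++ compile c2 d (pc + size (compile
    c1 d pc)) ++ post.
    by rewrite eqP1 !catA.
  have [|R2 [ag2 k2 e2]] := IH2 _ _ _ _ _ _ eqP2 _ ag1.
    by rewrite size_cat eqpc.
  exists R2; split=> // [j jd|fuel]; first by rewrite k2 // k1.
  by rewrite /= -addnA e1 e2 size_cat addnA.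
- set head := compile_expr (capped e) d.
  set body := compile c1 d.+1 (pc + size head + 3).
  set m := eval inp s (capped e).
  set L := pc + size head.
  have eqh : P = pre ++ head ++ ([:: Jumpz (tmp d) (L + size body + 5);
          Const (tmp d.+1) 1; Defs.Sub (tmp d) (tmp d) (tmp d.+1)] ++
      body ++ [:: Const (tmp d.+1) 0; Jumpz (tmp d.+1) L] ++ post).
    by rewrite eqP {1}/compile -/compile -/head -/body -!catA.
  have [v fr] := run_compile_expr (capped e) d ag.
  rewrite -/head -/m in v fr; set R0 := run head R in v fr.
  (* One full round, from the test at address [L] back to it, with a counter that is not yet
     zero. *)
  have round (j : nat) (s1 : state) (R1 : memory) : agree s1 R1 ->
    R1 (tmp d) = j.+1 -> exists R2, [/\ agree (sem inp c1 s1) R2,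
      R2 (tmp d) = j, forall i, i < d -> R2 (tmp i) = R1 (tmp i) &
      forall fuel, exec P inp (5 + cost c1 s1 + fuel) L R1 = exec P inp fuel L
        R2].
    move=> ag1 v1.
    have o1 : onth P L = Some (Jumpz (tmp d) (L + size body + 5)).
      by rewrite eqh /L eqpc -size_cat catA onth_mid.
    pose init := [:: Const (tmp d.+1) 1; Defs.Sub (tmp d) (tmp d) (tmp d.+1)].
    pose pre2 := pre ++ head ++ [:: Jumpz (tmp d) (L + size body + 5)].
    have eq2 : P = pre2 ++ init ++ (body ++ [:: Const (tmp d.+1) 0;
      Jumpz (tmp d.+1) L] ++ post).
      by rewrite eqh /pre2 /init -!catA.
    have s2 : L.+1 = size pre2
      by rewrite /pre2 catA size_cat addn1 size_cat -eqpc.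
    have ag2 : agree s1 (run init R1).
      apply: (agree_frame (d := d) ag1) => /=.
      by do 2 (apply: frame_trans; last by apply: frame_upd).
    have v2 : run init R1 (tmp d) = j.
      rewrite /= !upd_eq upd_neq; last by rewrite tmp_eq; lia.
      by rewrite v1 subn1.
    have fr1 : frame d R1 (run init R1).
      by do 2 (apply: frame_trans; last by apply: frame_upd).
    have eq3 : P = (pre2 ++ init) ++ body ++ ([:: Const (tmp d.+1) 0;
      Jumpz (tmp d.+1) L] ++ post).
      by rewrite eq2 -!catA.
    have s3 : L + 3 = size (pre2 ++ init) by rewrite size_cat -s2 /=; lia.
    have [R3 [ag3 k3 e3]] := IH1 _ _ _ _ _ _ eq3 s3 ag2.
    have eq4 : P = ((pre2 ++ init) ++ body) ++ [:: Const (tmp d.+1) 0] ++ ([::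
      Jumpz (tmp d.+1) L] ++ post).
      by rewrite eq3 -!catA.
    have s4 : L + 3 + size body = size ((pre2 ++ init) ++ body).
      by rewrite size_cat -s3.
    have o5 : onth P (L + 3 + size body + 1) = Some (Jumpz (tmp d.+1) L).
      rewrite s4 addn1.
      have -> : P = rcons ((pre2 ++ init) ++ body) (Const (tmp d.+1) 0) ++
        Jumpz (tmp d.+1) L :: post.
        by rewrite eq4 -cats1 -!catA.
      by rewrite -(size_rcons _ (Const (tmp d.+1) 0)) onth_mid.
    exists (upd R3 (tmp d.+1) 0); split.
    + by apply: (agree_frame (d := d) ag3); apply: frame_upd.
    + rewrite upd_neq; last by rewrite tmp_eq; lia.
      by rewrite (k3 d (ltnSn d)) v2.
    + move=> i id; rewrite upd_neq; last by rewrite tmp_eq; lia.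
      by rewrite (k3 i (leqW id)) (frame_tmp fr1).
    move=> fuel.
    have -> : 5 + cost c1 s1 + fuel = (2 + (cost c1 s1 + (1 + fuel.+1))).+1
      by lia.
    rewrite (exec_jumpz _ _ o1) v1 -[2]/(size init).
    rewrite (exec_straight _ _ eq2 s2) //.
    have -> : L.+1 + size init = L + 3 by rewrite /=; lia.
    rewrite e3 -/body -[1 + _]/(size [:: Const (tmp d.+1) 0] + fuel.+1).
    rewrite (exec_straight _ _ eq4 s4) //.
    by rewrite (exec_jumpz _ _ o5) /= upd_eq eqxx.
  have loop (j : nat) : j <= m -> exists R1, [/\ agree (iter j (sem inp c1) s)
    R1,
      R1 (tmp d) = m - j, forall i, i < d -> R1 (tmp i) = R (tmp i) &
      forall fuel, exec P inp (\sum_(i < j) (5 + cost c1 (iter i (sem inp c1)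
        s)) + fuel) L R0
        = exec P inp fuel L R1].
    elim: j => [|j IHj] jm.
      exists R0; split=> //.
      - exact: agree_frame ag fr.
      - by rewrite v subn0.
      - by move=> i id; rewrite (frame_tmp fr).
      - by move=> fuel; rewrite big_ord0.
    have [|R1 [ag1 v1 k1 e1]] := IHj; first by lia.
    have [|R2 [ag2 v2 k2 e2]] := round (m - j.+1) _ _ ag1; first by rewrite v1;
      lia.
    exists R2; split=> // [i id|fuel]; first by rewrite k2 ?k1.
    by rewrite big_ord_recr /= -addnA e1 e2.
  have [R1 [ag1 v1 k1 e1]] := loop m (leqnn m).
  exists R1; split=> // fuel.
  rewrite /cost -/cost -/m -(size_compile_expr (capped e) d) -/head.
  rewrite -!addnA (exec_straight _ _ eqh eqpc) ?straight_compile_expr // -/R0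
    -/L.
  (* The unit moved behind the rounds pays for the last test, which finds the counter at 0 and
     leaves the loop. *)
  have -> : forall x y, 1 + (x + y) = x + y.+1 by lia.
  have oL : onth P L = Some (Jumpz (tmp d) (L + size body + 5)).
    by rewrite eqh /L eqpc -size_cat catA onth_mid.
  rewrite e1 (exec_jumpz _ _ oL) v1 subnn eqxx.
  congr (exec _ inp fuel _ R1).
  rewrite -[compile _ _ _]/(head ++ [:: Jumpz (tmp d) (L + size body + 5);
    Const (tmp d.+1) 1; Defs.Sub (tmp d) (tmp d) (tmp d.+1)] ++
    body ++ [:: Const (tmp d.+1) 0; Jumpz (tmp d.+1) L]).
  by rewrite /L; move: (head) (body) => h b; rewrite !size_cat /=; lia.
Qed.

(** The 2 extra steps are the test of the output variable and the halting instruction. All registers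
    being 0 represents the state in which all variables and table entries are 0. *)
Lemma exec_compile (c : cmd) (out fuel : nat) :
  let code := compile c 0 0 in
  let s := sem inp c (State (fun=> 0) (fun=> 0)) in
  cost c (State (fun=> 0) (fun=> 0)) + 2 <= fuel ->
  answers_within
    (code ++ [:: Jumpz (3 * out) (size code + 2); Accept; Reject])
    inp fuel (var s out != 0).
Proof.
move=> code s hf; set P := _ ++ _.
have eqP : P = [::] ++ code ++ [:: Jumpz (3 * out) (size code + 2); Accept;
  Reject] by [].
have ag0 : agree (State (fun=> 0) (fun=> 0)) (fun=> 0) by [].
have [R [[ag _] _ ex]] := compile_correct eqP erefl ag0.
have o0 : onth P (size code) = Some (Jumpz (3 * out) (size code + 2)).
  exact: onth_mid.
rewrite /answers_within -(subnKC hf) -!addnA ex add0n.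
rewrite [2 + _]addSn (exec_jumpz _ _ o0) ag -/s add1n.
have o1 : onth P (size code).+1 = Some Accept.
  by rewrite /P onth_cat ltnNge leqnSn /= subSnn.
have o2 : onth P (size code + 2) = Some Reject.
  by rewrite /P onth_cat ltnNge leq_addr /= addKn.
move: o1 o2; set p1 := _.+1; set p2 := _ + 2; clearbody p1 p2.
by case: (var s out) => [|v] o1 o2; rewrite /= ?o1 ?o2.
Qed.

(** * What a command leaves unchanged, and the polynomial bound on its running time *)

Fixpoint writes (c : cmd) : seq nat :=
  match c with
  | Assign x _ => [:: x]
  | Put _ _ => [::]
  | Seq c1 c2 => writes c1 ++ writes c2
  | Loop _ c1 => writes c1
  end.

Lemma iter_inv (T : Type) (I : nat -> T -> Prop) (f : T -> T) (m : nat) (x : T)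
  :
  I 0 x -> (forall j y, j < m -> I j y -> I j.+1 (f y)) -> I m (iter m f x).
Proof.
move=> I0 IS; suff : forall j, j <= m -> I j (iter j f x) by apply.
by elim=> // j IH jm; apply: IS => //; apply: IH; apply: ltnW.
Qed.

Lemma sem_unwritten (c : cmd) (x : nat) (s : state) :
  x \notin writes c -> var (sem inp c s) x = var s x.
Proof.
elim: c s => [y e|a e|c1 IH1 c2 IH2|e c1 IH1] s //=.
- by rewrite inE /override -[eqn x y]/(x == y) => /negbTE ->.
- by rewrite mem_cat negb_or => /andP[h1 h2]; rewrite IH2 // IH1.
- move=> h; apply: (iter_inv (I := fun _ s' => var s' x = var s x)) => //.
  by move=> j s' _ <-; apply: IH1.
Qed.

Fixpoint puts (c : cmd) : bool :=
  match c with
  | Assign _ _ => false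
  | Put _ _ => true
  | Seq c1 c2 => puts c1 || puts c2
  | Loop _ c1 => puts c1
  end.

Lemma sem_tab (c : cmd) (s : state) : ~~ puts c -> tab (sem inp c s) = tab s.
Proof.
elim: c s => [y e|a e|c1 IH1 c2 IH2|e c1 IH1] s //=.
- by rewrite negb_or => /andP[h1 h2]; rewrite IH2 // IH1.
- move=> h; apply: (iter_inv (I := fun _ s' => tab s' = tab s)) => //.
  by move=> j s' _ <-; apply: IH1.
Qed.

Lemma eval_capped (e : expr) (s : state) :
  eval inp s (capped e) = minn (eval inp s e) (var s 0).
Proof. by rewrite /=; lia. Qed.

End Correctness.

(** The cap stays constant during such a command and bounds the rounds of every loop, so each level
    of nesting costs one more factor of cap + 1. A single constant serves as factor and as exponent,
    which makes it easy to add up over the parts of a command. *)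
Lemma cost_poly (c : cmd) : 0 \notin writes c ->
  exists A, forall inp s, cost inp c s <= A * (var s 0).+1 ^ A.
Proof.
elim: c => [y e|a e|c1 IH1 c2 IH2|e c1 IH1] /=.
- move=> _; exists (size (compile_expr e 0) + 2) => inp s.
  by rewrite leq_pmulr // expn_gt0.
- move=> _; exists (size (compile_expr a 0) + 4 + size (compile_expr e 0) + 1)
    => inp s.
  by rewrite leq_pmulr // expn_gt0.
- rewrite mem_cat negb_or => /andP[h1 h2].
  have [A1 H1] := IH1 h1; have [A2 H2] := IH2 h2.
  exists (A1 + A2) => inp s; rewrite mulnDl.
  apply: leq_add; first apply: leq_trans (H1 _ _) _.
    by rewrite leq_mul2l leq_pexp2l ?orbT // leq_addr.
  apply: leq_trans (H2 _ _) _; rewrite sem_unwritten //.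
  by rewrite leq_mul2l leq_pexp2l ?orbT // leq_addl.
- move=> h; have [A H] := IH1 h; set w := size _.
  exists (w + 6 + A) => inp s; set b := (var s 0).+1.
  have le : forall j, 5 + cost inp c1 (iter j (sem inp c1) s) <= (5 + A) * b ^
    A.
    move=> j; rewrite mulnDl; apply: leq_add.
      by rewrite leq_pmulr // expn_gt0.
    have -> : b = (var (iter j (sem inp c1) s) 0).+1; last exact: H.
    congr _.+1; elim: j => //= j IHj; rewrite sem_unwritten //.
  set m := _ - (_ - _); have mb : m <= b by rewrite /m /b; lia.
  have -> : w + 6 + A = (w + 1) + (5 + A) by lia.
  rewrite mulnDl; apply: leq_add; first by rewrite leq_pmulr // expn_gt0.
  apply: leq_trans (_ : \sum_(j < m) (5 + A) * b ^ A <= _).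
    by apply: leq_sum => j _.
  rewrite sum_nat_const card_ord mulnCA leq_mul2l; apply/orP; right.
  apply: leq_trans (_ : b * b ^ A <= _); first by rewrite leq_mul2r mb orbT.
  by rewrite -expnS leq_pexp2l //; lia.
Qed.

(** * Conditionals and division *)

Section Macros.

Variable inp : seq nat.
Implicit Types (s : state) (c : cmd) (e : expr).

Lemma sem_seq c1 c2 s : sem inp (Seq c1 c2) s = sem inp c2 (sem inp c1 s).
Proof. by []. Qed.

Lemma var_assign x e s y :
  var (sem inp (Assign x e) s) y = if y == x then eval inp s e else var s y.
Proof. by []. Qed.

Lemma tab_assign x e s : tab (sem inp (Assign x e) s) = tab s.
Proof. by []. Qed.

Lemma var_put a e s : var (sem inp (Put a e) s) = var s.
Proof. by []. Qed.

Lemma tab_put a e s :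
  tab (sem inp (Put a e) s) = override (tab s) (eval inp s a) (eval inp s e).
Proof. by []. Qed.

Lemma sem_loopE e c s :
  sem inp (Loop e c) s =
  iter (minn (eval inp s e) (var s 0)) (sem inp c) s.
Proof. by rewrite -eval_capped. Qed.

(** The first hypothesis says that the cap does not cut the loop short. Each round is handed the
    frame facts, so that an invariant [I] needs to mention only what the body changes. *)
Lemma sem_loop (I : nat -> state -> Prop) e c s :
  eval inp s e <= var s 0 -> I 0 s ->
  (forall j y, j < eval inp s e ->
     (forall x, x \notin writes c -> var y x = var s x) ->
     (~~ puts c -> tab y = tab s) -> I j y -> I j.+1 (sem inp c y)) ->
  I (eval inp s e) (sem inp (Loop e c) s).
Proof.
move=> lec I0 IS; rewrite sem_loopE (minn_idPl lec).
pose J j y := [/\ forall x, x \notin writes c -> var y x = var s x,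
  ~~ puts c -> tab y = tab s & I j y].
suff : J (eval inp s e) (iter (eval inp s e) (sem inp c) s) by case.
apply: iter_inv => // j y jm [h1 h2 h3]; split.
- by move=> x xc; rewrite sem_unwritten // h1.
- by move=> pc; rewrite sem_tab // h2.
- exact: IS.
Qed.

(** With truncated subtraction, 1 - (1 - e) is 0 or 1 according to whether e vanishes, so a loop
    replaces the conditional. *)
Definition IfNZ e c : cmd := Loop (Minus (Lit 1) (Minus (Lit 1) e)) c.

Lemma sem_ifnz e c s : 0 < var s 0 ->
  sem inp (IfNZ e c) s = if eval inp s e == 0 then s else sem inp c s.
Proof.
move=> c0; rewrite /IfNZ sem_loopE.
set m := minn _ _; have -> : m = (eval inp s e != 0) by rewrite /m /=; lia.
by case: (_ == 0).
Qed.

Definition DivMod (x r b : nat) : cmd :=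
  Seq (Assign r (Var x)) (Seq (Assign x (Lit 0))
    (Loop (Var r) (IfNZ (Minus (Plus (Var r) (Lit 1)) (Var b))
      (Seq (Assign r (Minus (Var r) (Var b)))
           (Assign x (Plus (Var x) (Lit 1))))))).

Lemma sem_divmod (x r b : nat) s :
  uniq [:: 0; x; r; b] -> var s x <= var s 0 -> 0 < var s 0 -> 0 < var s b ->
  var (sem inp (DivMod x r b) s) x = var s x %/ var s b /\
  var (sem inp (DivMod x r b) s) r = var s x %% var s b.
Proof.
rewrite [uniq _]/= !inE !negb_or => /and4P[/and3P[x0 r0 b0] /andP[xr xb] rb _]
  xc c0 bp.
rewrite /DivMod !sem_seq; set s1 := sem inp _ (sem inp _ s).
have e1 y : var s1 y = if y == x then 0 else if y == r then var s x else var s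
  y.
  by rewrite /s1 !var_assign.
clearbody s1.
have s1r : var s1 r = var s x by rewrite e1 eqxx eq_sym (negbTE xr).
have s1x : var s1 x = 0 by rewrite e1 eqxx.
have s1b : var s1 b = var s b
  by rewrite e1 eq_sym (negbTE xb) eq_sym (negbTE rb).
have s1c : var s1 0 = var s 0 by rewrite e1 (negbTE x0) (negbTE r0).
set c1 := IfNZ _ _.
(* Either the remainder is already below the divisor, or each of the j rounds has subtracted. *)
have := @sem_loop (fun j y => var y x * var s b + var y r = var s x /\
  (var y r < var s b \/ var y x = j)) (Var r) c1 s1.
rewrite [eval _ _ _]/= s1r s1c => /(_ xc) [].
- by rewrite s1x; split=> //; right.
- move=> j y jm fr _ [eqxr alt].
  have yb : var y b = var s b.
    by rewrite fr ?s1b //= !inE negb_or eq_sym rb eq_sym xb.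
  have yc : var y 0 = var s 0.
    by rewrite fr ?s1c //= !inE negb_or r0 x0.
  rewrite /c1 sem_ifnz ?yc // [eval _ _ _]/= yb.
  case: eqP => h.
    split=> //; left; lia.
  rewrite sem_seq !var_assign !eqxx eq_sym (negbTE xr) [eval _ _ _]/= yb.
  rewrite [eval _ _ _]/= /override -[eqn x r]/(x == r) (negbTE xr).
  split; first by lia.
  by right; lia.
move=> eqxr alt.
set X := var _ x in eqxr alt *; set Y := var _ r in eqxr alt *.
(* If every round subtracted, the quotient equals the dividend, and then the remainder is 0. *)
have lt : Y < var s b by case: alt => // ?; nia.
by rewrite -eqxr divnMDl // divn_small // addn0 modnMDl modn_small.
Qed.

End Macros.

(** * The dynamic program *)

Local Opaque sem.

Local Notation vcap := 0.
Local Notation vn := 1.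
Local Notation vT := 2.
Local Notation vL := 3.
Local Notation vB := 4.
Local Notation vS := 5.
Local Notation vsq := 6.
Local Notation vp := 7.
Local Notation vf := 8.
Local Notation ve := 9.
Local Notation vbad := 10.
Local Notation vcnt := 11.
Local Notation vbest := 12.
Local Notation vff := 13.
Local Notation vee := 14.
Local Notation vrf := 15.
Local Notation vre := 16.
Local Notation vm := 17.
Local Notation vv := 18.
Local Notation vu := 19.
Local Notation vptr := 20.
Local Notation vdom := 21.
Local Notation vz := 22.
Local Notation vK := 23.
Local Notation vnT := 24.
Local Notation vt := 25.
Local Notation vq := 26.
Local Notation vD := 27.
Local Notation vbig := 28.
Local Notation vout := 29.
Local Notation vk := 30.

Definition digit (B f u : nat) : nat := f %/ B ^ u %% B.

(** One summand per rule, each 0 exactly when the rule holds: vertex u burns at most one unit, it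
    burns no more than it has, and it rests only when no interval is in progress. Summing the
    violations makes legality a single test for 0. *)
Definition badness (B L f e u : nat) : nat :=
  (digit B e u - 1) + (digit B e u - digit B f u) +
  (if digit B e u == 0 then digit B f u %% L else 0).

Definition legal (n B L f e : nat) : bool :=
  \sum_(u < n) badness B L f e u == 0.

Section Program.

Variable inp : seq nat.
Implicit Types s y : state.

(* p is the input position of the adjacency matrix of the current time. *)
Definition dom_count (n B p e v : nat) : nat :=
  \sum_(u < n) if digit B e u == 0 then 0
               else nth 0 inp (p + v + u * n) + (u == v :> nat).

Definition gain (n B p e : nat) : nat :=
  \sum_(v < n) (dom_count n B p e v != 0).

Definition digit_code : cmd :=
  Seq (DivMod vff vrf vB) (Seq (DivMod vee vre vB)
  (Seq (Assign vz (Var vrf)) (Seq (DivMod vz vm vL)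
  (Seq (Assign vbad (Plus (Var vbad)
          (Plus (Minus (Var vre) (Lit 1)) (Minus (Var vre) (Var vrf)))))
       (IfNZ (Minus (Lit 1) (Var vre))
          (Assign vbad (Plus (Var vbad) (Var vm)))))))).

Definition legal_code : cmd :=
  Seq (Assign vbad (Lit 0)) (Seq (Assign vff (Var vf))
  (Seq (Assign vee (Var ve)) (Loop (Var vn) digit_code))).

Definition dom_code : cmd :=
  Seq (DivMod vee vre vB)
  (Seq (IfNZ (Var vre) (Assign vdom (Plus (Var vdom)
         (Plus (Input (Var vptr))
           (Minus (Minus (Lit 1) (Minus (Var vu) (Var vv)))
                  (Minus (Var vv) (Var vu)))))))
  (Seq (Assign vptr (Plus (Var vptr) (Var vn)))
       (Assign vu (Plus (Var vu) (Lit 1))))).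

Definition vertex_code : cmd :=
  Seq (Assign vdom (Lit 0)) (Seq (Assign vee (Var ve))
  (Seq (Assign vu (Lit 0)) (Seq (Assign vptr (Plus (Var vp) (Var vv)))
  (Seq (Loop (Var vn) dom_code)
  (Seq (Assign vcnt (Plus (Var vcnt) (Minus (Lit 1) (Minus (Lit 1) (Var
    vdom)))))
       (Assign vv (Plus (Var vv) (Lit 1)))))))).

Definition gain_code : cmd :=
  Seq (Assign vcnt (Lit 0)) (Seq (Assign vv (Lit 0)) (Loop (Var vn)
    vertex_code)).

Definition try_code : cmd :=
  Seq legal_code (Seq gain_code
  (Seq (IfNZ (Minus (Lit 1) (Var vbad)) (Assign vbest (Plus (Var vbest)
         (Minus (Plus (Var vcnt) (Entry (Minus (Var vf) (Var ve))))
                (Var vbest)))))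
       (Assign ve (Plus (Var ve) (Lit 1))))).

Definition state_code : cmd :=
  Seq (Assign vf (Minus (Var vf) (Lit 1))) (Seq (Assign vbest (Lit 0))
  (Seq (Assign ve (Lit 0)) (Seq (Loop (Plus (Var vf) (Lit 1)) try_code)
       (Put (Var vf) (Var vbest))))).

(* The table is updated in place: f runs downwards, so that the entries below f
   still belong to the next time step. *)
Definition time_code : cmd :=
  Seq (Assign vp (Minus (Var vp) (Var vsq))) (Seq (Assign vf (Var vS))
      (Loop (Var vS) state_code)).

Definition ready s : Prop :=
  [/\ 0 < var s vcap, var s vn <= var s vcap, var s vS <= var s vcap,
      0 < var s vB & 0 < var s vL].

Lemma ready_ext s y : ready s ->
  (forall x, x <= vS -> var y x = var s x) -> ready y.
Proof. by move=> h e; rewrite /ready !e. Qed.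

Lemma eq_1sub x : (1 - x == 0) = (x != 0).
Proof. by case: x. Qed.

Lemma digit_step s f e u : ready s ->
  f <= var s vcap -> e <= var s vcap ->
  var s vff = f %/ var s vB ^ u -> var s vee = e %/ var s vB ^ u ->
  [/\ var (sem inp digit_code s) vff = f %/ var s vB ^ u.+1,
      var (sem inp digit_code s) vee = e %/ var s vB ^ u.+1 &
      var (sem inp digit_code s) vbad =
        var s vbad + badness (var s vB) (var s vL) f e u].
Proof.
case=> c0 _ _ B0 L0 fc ec ff ee.
rewrite /digit_code 5!sem_seq.
have [] := @sem_divmod inp vff vrf vB s isT; rewrite ?ff //.
  exact: leq_trans (leq_div _ _) fc.
(* From here on every intermediate state is made opaque and known only through the values just
   computed and the fact that unwritten variables keep theirs. *)
have := @sem_unwritten inp (DivMod vff vrf vB) ^~ s.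
set s1 := sem _ _ s; clearbody s1 => u1 q1 r1.
have [] := @sem_divmod inp vee vre vB s1 isT; rewrite ?u1 ?ee //.
  exact: leq_trans (leq_div _ _) ec.
have := @sem_unwritten inp (DivMod vee vre vB) ^~ s1.
set s2 := sem _ _ s1; clearbody s2 => u2 q2 r2.
set s3 := sem _ (Assign _ _) s2.
have e3 x : var s3 x = if x == vz then var s2 vrf else var s2 x by [].
clearbody s3.
have c3 : var s3 vcap = var s vcap by rewrite e3 /= u2 // u1.
have L3 : var s3 vL = var s vL by rewrite e3 /= u2 // u1.
have z3 : var s3 vz = digit (var s vB) f u by rewrite e3 /= u2 // r1.
have [] := @sem_divmod inp vz vm vL s3 isT; rewrite ?c3 ?L3 ?z3 //.
  apply: leq_trans (leq_mod _ _) _.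
  exact: leq_trans (leq_div _ _) fc.
have := @sem_unwritten inp (DivMod vz vm vL) ^~ s3.
set s4 := sem _ _ s3; clearbody s4 => u4 _ r4.
set s5 := sem _ (Assign _ _) s4.
have e5 x : var s5 x = if x == vbad then var s4 vbad + ((var s4 vre - 1) + (var
  s4 vre - var s4 vrf)) else var s4 x by [].
clearbody s5.
have c5 : var s5 0 = var s 0 by rewrite e5 /= u4 // e3 /= u2 // u1.
have re5 : var s5 vre = digit (var s vB) e u by rewrite e5 /= u4 // e3 /= r2.
have rf5 : var s4 vrf = digit (var s vB) f u by rewrite u4 // e3 /= u2 // r1.
have m5 : var s5 vm = digit (var s vB) f u %% var s vL by rewrite e5 /= r4.
have bad5 : var s5 vbad = var s vbad + ((digit (var s vB) e u - 1) +
    (digit (var s vB) e u - digit (var s vB) f u)).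
  by rewrite e5 /= rf5 (u4 vre) // e3 /= r2 u4 // e3 /= u2 // u1.
have ff5 : var s5 vff = f %/ var s vB ^ u.+1.
  by rewrite e5 /= u4 // e3 /= u2 // q1 -divnMA -expnSr.
have ee5 : var s5 vee = e %/ var s vB ^ u.+1.
  by rewrite e5 /= u4 // e3 /= q2 -divnMA -expnSr.
rewrite sem_ifnz ?c5 // /badness /= re5.
rewrite eq_1sub; case: eqP => d0 /=; rewrite ?var_assign /= ff5 ee5 bad5 ?m5.
  by rewrite -!addnA.
by rewrite addn0.
Qed.

Lemma legal_code_correct s : ready s ->
  var s vf < var s vS -> var s ve < var s vS ->
  (var (sem inp legal_code s) vbad == 0) =
  legal (var s vn) (var s vB) (var s vL) (var s vf) (var s ve).
Proof.
move=> rs fS eS; rewrite /legal_code 3!sem_seq;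
  set s1 := sem _ _ (sem _ _ (sem _ _ s)).
have e1 x : var s1 x = if x == vee then var s ve else if x == vff then var s vf
    else if x == vbad then 0 else var s x by [].
clearbody s1.
have := @sem_loop inp (fun j y =>
  [/\ var y vff = var s vf %/ var s vB ^ j, var y vee = var s ve %/ var s vB ^
    j &
   var y vbad = \sum_(u < j) badness (var s vB) (var s vL) (var s vf) (var s
     ve) u])
  (Var vn) digit_code s1.
rewrite /= !e1 /=; case: (rs) => c0 nc Sc B0 L0 [] //.
- by rewrite !divn1 big_ord0.
- move=> j y jn fr _ [yff yee ybad].
  have f2 x : x <= vS -> var y x = var s x.
    by case: x => [|[|[|[|[|[|x]]]]]] // _; rewrite fr // e1.
  have := @digit_step y (var s vf) (var s ve) j (ready_ext rs f2).
  rewrite (f2 vcap) // (f2 vB) // (f2 vL) // => h; case: h => //.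
  - exact: leq_trans (ltnW fS) Sc.
  - exact: leq_trans (ltnW eS) Sc.
  - by move=> -> -> ->; rewrite big_ord_recr /= ybad.
by move=> _ _ ->.
Qed.

Lemma sub_eqE a b : 1 - (a - b) - (b - a) = (a == b).
Proof. by lia. Qed.

Lemma dom_step s e u : ready s -> e <= var s vcap ->
  var s vee = e %/ var s vB ^ u ->
  [/\ var (sem inp dom_code s) vee = e %/ var s vB ^ u.+1,
      var (sem inp dom_code s) vu = (var s vu).+1,
      var (sem inp dom_code s) vptr = var s vptr + var s vn &
      var (sem inp dom_code s) vdom = var s vdom +
       if digit (var s vB) e u == 0 then 0
       else nth 0 inp (var s vptr) + (var s vu == var s vv)].
Proof.
case=> c0 _ _ B0 L0 ec ee.
rewrite /dom_code 3!sem_seq.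
have [] := @sem_divmod inp vee vre vB s isT; rewrite ?ee //.
  exact: leq_trans (leq_div _ _) ec.
have := @sem_unwritten inp (DivMod vee vre vB) ^~ s.
set s1 := sem _ _ s; clearbody s1 => u1 q1 r1.
rewrite !var_assign /= sem_ifnz ?u1 //= r1 -/(digit _ e u).
case: eqP => d0; rewrite /= ?var_assign /= q1 !u1 // -divnMA -expnSr addn1.
  by rewrite addn0.
by rewrite sub_eqE.
Qed.

Lemma sub1_sub x : 1 - (1 - x) = (x != 0).
Proof. by case: x. Qed.

Lemma vertex_step s : ready s -> var s ve < var s vS ->
  var (sem inp vertex_code s) vv = (var s vv).+1 /\
  var (sem inp vertex_code s) vcnt = var s vcnt +
    (dom_count (var s vn) (var s vB) (var s vp) (var s ve) (var s vv) != 0).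
Proof.
move=> rs eS; rewrite /vertex_code 6!sem_seq.
set s1 := sem _ _ (sem _ _ (sem _ _ (sem _ _ s))).
have e1 x : var s1 x = if x == vptr then var s vp + var s vv else
    if x == vu then 0 else if x == vee then var s ve else
    if x == vdom then 0 else var s x by [].
clearbody s1.
have := @sem_loop inp (fun j y =>
  [/\ var y vee = var s ve %/ var s vB ^ j, var y vu = j,
   var y vptr = var s vp + var s vv + j * var s vn &
   var y vdom = \sum_(u < j) if digit (var s vB) (var s ve) u == 0 then 0
     else nth 0 inp (var s vp + var s vv + u * var s vn) + (u == var s vv :>
       nat)])
  (Var vn) dom_code s1.
rewrite /= !e1 /=; case: (rs) => c0 nc Sc B0 L0 [] //.
- by rewrite divn1 big_ord0 mul0n addn0.
- move=> j y jn fr _ [yee yu yptr ydom].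
  have f2 x : x <= vS -> var y x = var s x.
    by case: x => [|[|[|[|[|[|x]]]]]] // _; rewrite fr // e1.
  have := @dom_step y (var s ve) j (ready_ext rs f2).
  rewrite (f2 vcap) // (f2 vB) // (f2 vn) // => h; case: h => //.
    exact: leq_trans (ltnW eS) Sc.
  move=> -> -> -> ->; rewrite big_ord_recr /= ydom yu yptr.
  by rewrite [var y vv]fr // e1 /=; split=> //; lia.
have := @sem_unwritten inp (Loop (Var vn) dom_code) ^~ s1.
set s2 := sem _ _ s1; clearbody s2 => u2 _ _ _ d2.
rewrite !var_assign /= !var_assign /= u2 // e1 /= u2 // e1 /=; split;
  first by lia.
by rewrite d2 sub1_sub.
Qed.

Lemma gain_code_correct s : ready s -> var s ve < var s vS ->
  var (sem inp gain_code s) vcnt =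
  gain (var s vn) (var s vB) (var s vp) (var s ve).
Proof.
move=> rs eS; rewrite /gain_code 2!sem_seq; set s1 := sem _ _ (sem _ _ s).
have e1 x : var s1 x = if x == vv then 0 else if x == vcnt then 0
    else var s x by [].
clearbody s1.
have := @sem_loop inp (fun j y => var y vv = j /\
   var y vcnt = \sum_(v < j) (dom_count (var s vn) (var s vB) (var s vp) (var s
     ve) v != 0))
  (Var vn) vertex_code s1.
rewrite /= !e1 /=; case: (rs) => c0 nc Sc B0 L0 [] //.
- by rewrite big_ord0.
- move=> j y jn fr _ [yv ycnt].
  have f2 x : x <= ve -> var y x = var s x.
    by case: x => [|[|[|[|[|[|[|[|[|[|x]]]]]]]]]] // _; rewrite fr // e1.
  have ry : ready y by apply: (ready_ext rs) => x xS; apply: f2; lia.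
  have := @vertex_step y ry.
  rewrite ycnt yv !f2 // => h; case: h => // -> ->.
  by rewrite big_ord_recr.
Qed.

Lemma try_step s : ready s -> var s vf < var s vS -> var s ve <= var s vf ->
  var (sem inp try_code s) ve = (var s ve).+1 /\
  var (sem inp try_code s) vbest =
    if legal (var s vn) (var s vB) (var s vL) (var s vf) (var s ve) then
      maxn (var s vbest) (gain (var s vn) (var s vB) (var s vp) (var s ve) +
                          tab s (var s vf - var s ve))
    else var s vbest.
Proof.
move=> rs fS ef; have eS := leq_ltn_trans ef fS.
rewrite /try_code 3!sem_seq; have := legal_code_correct rs fS eS.
have := @sem_tab inp legal_code s isT.
have := @sem_unwritten inp legal_code ^~ s.
set s1 := sem _ _ s; clearbody s1 => u1 t1 bad1.
have rs1 : ready s1.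
  by apply: (ready_ext rs) => -[|[|[|[|[|[|x]]]]]] // _; rewrite u1.
have := @gain_code_correct s1 rs1.
rewrite !u1 // => /(_ eS).
have := @sem_tab inp gain_code s1 isT.
have := @sem_unwritten inp gain_code ^~ s1.
set s2 := sem _ _ s1; clearbody s2 => u2 t2 cnt2.
rewrite !var_assign /=.
have c2 : 0 < var s2 vcap by rewrite u2 // u1 //; case: rs.
rewrite sem_ifnz //= (u2 vbad) // -bad1.
rewrite eq_1sub; case: eqP => h; rewrite /= ?var_assign /=;
  rewrite ?cnt2 ?(u2 ve) ?(u2 vf) ?(u2 vbest) // ?u1 // ?t2 ?t1 addn1 //.
by split=> //; rewrite maxnE addnC.
Qed.

(** The Bellman step: [W] is the optimum from the next time on, and [e], with digits 0 and 1,
    encodes the set of vertices active now, so that [f - e] is the fuel left. *)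
Definition best_value (n B L p : nat) (W : nat -> nat) (f : nat) : nat :=
  \max_(e < f.+1 | legal n B L f e) (gain n B p e + W (f - e)).

Lemma state_step s : ready s -> 0 < var s vf -> var s vf <= var s vS ->
  var (sem inp state_code s) vf = (var s vf).-1 /\
  tab (sem inp state_code s) =
    override (tab s) (var s vf).-1
      (best_value (var s vn) (var s vB) (var s vL) (var s vp) (tab s) (var s
        vf).-1).
Proof.
move=> rs f0 fS; rewrite /state_code 4!sem_seq.
set s1 := sem _ _ (sem _ _ (sem _ _ s)).
have e1 x : var s1 x = if x == ve then 0 else if x == vbest then 0 else
    if x == vf then var s vf - 1 else var s x by [].
have t1 : tab s1 = tab s by [].
clearbody s1.
have := @sem_loop inp (fun j y => var y ve = j /\
   var y vbest = \max_(e < j | legal (var s vn) (var s vB) (var s vL) (var s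
     vf).-1 e)
     (gain (var s vn) (var s vB) (var s vp) e + tab s ((var s vf).-1 - e)))
  (Plus (Var vf) (Lit 1)) try_code s1.
rewrite /= !e1 /= subn1 addn1 prednK //; case: (rs) => c0 nc Sc B0 L0 [] //.
- by lia.
- by rewrite big_ord0.
- move=> j y jn fr /(_ isT) ty [ye ybest].
  have f2 x : x <= vp -> var y x = var s x.
    by case: x => [|[|[|[|[|[|[|[|x]]]]]]]] // _; rewrite fr // e1.
  have yf : var y vf = (var s vf).-1 by rewrite fr // e1 /= subn1.
  have ry : ready y by apply: (ready_ext rs) => x xS; apply: f2; lia.
  have := @try_step y ry.
  rewrite yf ye ybest !f2 // => h; case: h => //; [by lia | by lia |].
  move=> -> ->; split=> //.
  rewrite [RHS]big_mkcond big_ord_recr /= -big_mkcond /= ty t1.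
  by case: ifP => // _; rewrite maxn0.
have := @sem_tab inp (Loop (Plus (Var vf) (Lit 1)) try_code) s1 isT.
have := @sem_unwritten inp (Loop (Plus (Var vf) (Lit 1)) try_code) ^~ s1.
set s2 := sem _ _ s1; clearbody s2 => u2 t2 _ b2.
have f2 : var s2 vf = (var s vf).-1 by rewrite u2 // e1 /= subn1.
by rewrite var_put tab_put /= f2 b2 t2 t1 /best_value prednK.
Qed.

Lemma eq_best_value n B L p W W' f :
  (forall a, a <= f -> W a = W' a) ->
  best_value n B L p W f = best_value n B L p W' f.
Proof. by move=> h; apply: eq_bigr => e _; rewrite h // leq_subr. Qed.

Lemma time_step s : ready s ->
  var (sem inp time_code s) vp = var s vp - var s vsq /\
  forall a, a < var s vS -> tab (sem inp time_code s) a =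
    best_value (var s vn) (var s vB) (var s vL) (var s vp - var s vsq) (tab s)
      a.
Proof.
move=> rs; rewrite /time_code 2!sem_seq; set s1 := sem _ _ (sem _ _ s).
have e1 x : var s1 x = if x == vf then var s vS else
    if x == vp then var s vp - var s vsq else var s x by [].
have t1 : tab s1 = tab s by [].
clearbody s1.
have := @sem_unwritten inp (Loop (Var vS) state_code) ^~ s1 => ->; last by [].
rewrite e1 /=; split=> //.
have := @sem_loop inp (fun j y => var y vf = var s vS - j /\
   forall a, a < var s vS -> tab y a = if var s vS - j <= a then
     best_value (var s vn) (var s vB) (var s vL) (var s vp - var s vsq) (tab s)
       a
     else tab s a)
  (Var vS) state_code s1.
rewrite /= !e1 /=; case: (rs) => c0 nc Sc B0 L0 [] //.
- by rewrite subn0 t1; split=> // a aS; rewrite leqNgt aS.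
- move=> j y jS fr _ [yf ytab].
  have f2 x : x <= vS -> var y x = var s x.
    by case: x => [|[|[|[|[|[|x]]]]]] // _; rewrite fr // e1.
  have yp : var y vp = var s vp - var s vsq by rewrite fr // e1.
  have := @state_step y (ready_ext rs f2).
  rewrite yf yp !f2 // => h; case: h => //; [by lia | by lia |].
  move=> -> ->; split; first by lia.
  move=> a aS; rewrite /override -[eqn a _]/(a == _).
  case: eqP => [->|ne].
    rewrite ifT; last by lia.
    (* Only entries up to the current one are read, and none of them has been overwritten yet. *)
    by apply: eq_best_value => b bS; rewrite ytab ?ifF //; lia.
  rewrite ytab //; congr (if _ then _ else _); lia.
by move=> _ h a aS; rewrite h // subnn.
Qed.

End Program.

(** * The main program *)

Section Main.

Variable inp : seq nat.
Implicit Types (s y : state) (e : expr).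

Definition AddMul (x : nat) e (y : nat) : cmd :=
  Loop e (Assign x (Plus (Var x) (Var y))).

Lemma sem_addmul (x y : nat) e s : x != y -> eval inp s e <= var s vcap ->
  var (sem inp (AddMul x e y) s) x = var s x + eval inp s e * var s y.
Proof.
move=> xy ec; rewrite /AddMul.
have := @sem_loop inp (fun j z => var z x = var s x + j * var s y) e
  (Assign x (Plus (Var x) (Var y))) s ec; apply; first by rewrite mul0n addn0.
move=> j z _ fr _ zx; rewrite var_assign eqxx /= zx fr; first by lia.
by rewrite /= inE eq_sym.
Qed.

Definition sizes_code : cmd :=
  Seq (Assign vn (Input (Lit 0))) (Assign vT (Input (Lit 1))).

Definition square_code : cmd :=
  Seq (Assign vsq (Lit 0)) (AddMul vsq (Var vcap) vcap).

Definition Min e1 e2 : expr := Minus e1 (Minus e1 e2).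

Definition params_code : cmd :=
  Seq (Assign vk (Min (Input (Lit 2)) (Var vT)))
  (Seq (Assign vL (Plus (Min (Input (Lit 3)) (Var vT)) (Lit 1)))
  (Seq (Assign vK (Lit 0)) (Seq (AddMul vK (Var vk) vL)
  (Seq (Assign vnT (Lit 0)) (Seq (AddMul vnT (Var vn) vT)
  (Seq (Assign vt (Min (Input (Lit 4)) (Plus (Var vnT) (Lit 1))))
  (Seq (Assign vz (Min (Var vK) (Var vT)))
  (Seq (Assign vq (Lit 0)) (Seq (AddMul vq (Var vn) vz)
  (Seq (Assign vD (Lit 1)) (Seq (Loop (Var vt) (Assign vD (Plus (Var vD) (Var
    vD))))
  (Seq (Assign vbig (Lit 0)) (AddMul vbig (Var vcap) vD))))))))))))).

Definition power_code : cmd :=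
  Seq (Assign vz (Lit 0)) (Seq (AddMul vz (Var vB) vS) (Assign vS (Var vz))).

Definition dp_code : cmd :=
  Seq (Assign vB (Plus (Var vK) (Lit 1)))
  (Seq (Assign vS (Lit 1)) (Seq (Loop (Var vn) power_code)
  (Seq (Assign vsq (Lit 0)) (Seq (AddMul vsq (Var vn) vn)
  (Seq (Assign vp (Lit 5)) (Seq (AddMul vp (Var vT) vsq)
       (Loop (Var vT) time_code))))))).

(** Truncated differences of the form x + 1 - t are nonzero exactly when t <= x. If t <= [vq], the
    first one already says yes, whatever the table holds; if t > n T, the table is not consulted. So
    a table spoilt by the cap cannot do damage. *)
Definition answer_code : cmd :=
  Seq (Assign vout (Minus (Plus (Var vq) (Lit 1)) (Var vt)))
      (IfNZ (Minus (Plus (Var vnT) (Lit 1)) (Var vt))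
        (Assign vout (Plus (Var vout)
          (Minus (Plus (Entry (Minus (Var vS) (Lit 1))) (Lit 1)) (Var vt))))).

(** The cap grows in stages, each computed by loops that the preceding cap does not cut short.
    [sizes_code] has no loop and can run while the cap is still 0. *)
Definition main_code : cmd :=
  Seq sizes_code
  (Seq (Assign vcap (Plus (Plus (Var vn) (Var vT)) (Lit 1)))
  (Seq square_code (Seq (Assign vcap (Var vsq))
  (Seq params_code (Seq (Assign vcap (Var vbig)) (Seq dp_code answer_code)))))).

(** Here [j] counts the time steps that remain, so the current time is T - j; the matrices start at
    input position 5, behind the numbers n, T, k, l, t. *)
Fixpoint value (n B L T j f : nat) : nat :=
  if j isn't j'.+1 then 0
  else best_value inp n B L (5 + (T - j) * (n * n)) (value n B L T j') f.

Lemma dp_code_correct s :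
  let B := (var s vK).+1 in
  0 < var s vcap -> var s vn <= var s vcap -> var s vT <= var s vcap ->
  B <= var s vcap -> B ^ var s vn <= var s vcap -> 0 < var s vL ->
  tab s =1 (fun=> 0) ->
  var (sem inp dp_code s) vS = B ^ var s vn /\
  forall f, f < B ^ var s vn -> tab (sem inp dp_code s) f =
    value (var s vn) B (var s vL) (var s vT) (var s vT) f.
Proof.
move=> B c0 nc Tc Bc Sc L0 tab0; rewrite /dp_code 7!sem_seq.
set s1 := sem _ _ (sem _ _ s).
have e1 x : var s1 x = if x == vS then 1 else if x == vB then var s vK + 1
    else var s x by [].
have t1 : tab s1 = tab s by [].
clearbody s1.
have := @sem_loop inp (fun j y => var y vS = B ^ j) (Var vn) power_code s1.
rewrite /= !e1 /= => /(_ nc erefl) H.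
have hS : forall j y, j < var s vn ->
    (forall x, x \notin writes power_code -> var y x = var s1 x) ->
    (~~ puts power_code -> tab y = tab s1) -> var y vS = B ^ j ->
    var (sem inp power_code y) vS = B ^ j.+1.
  move=> j y jn fr _ yS; rewrite /power_code 2!sem_seq var_assign /=.
  rewrite sem_addmul //=; last first.
    by rewrite !var_assign /= !fr // !e1 /= addn1.
  by rewrite !var_assign /= yS fr // e1 /= addn1 add0n expnS.
have := H hS.
have := @sem_unwritten inp (Loop (Var vn) power_code) ^~ s1.
have := @sem_tab inp (Loop (Var vn) power_code) s1 isT.
set s2 := sem _ _ s1; clearbody s2 => t2 u2 S2.
set s3 := sem _ _ s2; set s4 := sem _ _ s3; set s5 := sem _ _ s4;
  set s6 := sem _ _ s5.
have v3 x : x != vsq -> var s3 x = var s2 x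
  by rewrite /s3 var_assign => /negbTE ->.
have v4 x : x != vsq -> var s4 x = var s2 x.
  by move=> xs; rewrite /s4 sem_unwritten ?v3 //= inE.
have v6 x : x \notin [:: vsq; vp] -> var s6 x = var s2 x.
  rewrite !inE negb_or => /andP[h1 h2]; rewrite /s6 sem_unwritten ?inE //.
  by rewrite /s5 var_assign (negbTE h2) v4.
have sq4 : var s4 vsq = var s vn * var s vn.
  have n3 : var s3 vn = var s vn by rewrite v3 // u2 // e1.
  have c3 : var s3 vcap = var s vcap by rewrite v3 // u2 // e1.
  by rewrite /s4 sem_addmul //= n3 ?c3 // /s3 var_assign.
have sq5 : var s5 vsq = var s vn * var s vn by rewrite /s5 var_assign.
have sq6 : var s6 vsq = var s vn * var s vn by rewrite /s6 sem_unwritten.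
have p6 : var s6 vp = 5 + var s vT * (var s vn * var s vn).
  have T5 : var s5 vT = var s vT by rewrite /s5 var_assign /= v4 // u2 // e1.
  have c5 : var s5 vcap = var s vcap
    by rewrite /s5 var_assign /= v4 // u2 // e1.
  by rewrite /s6 sem_addmul //= T5 ?c5 // sq5 /s5 var_assign.
have t6 : tab s6 =1 (fun=> 0).
  move=> a; rewrite /s6 sem_tab // /s5 tab_assign /s4 sem_tab //.
  by rewrite /s3 tab_assign t2 t1.
have S6 : var s6 vS = B ^ var s vn by rewrite v6.
have n6 : var s6 vn = var s vn by rewrite v6 // u2 // e1.
have T6 : var s6 vT = var s vT by rewrite v6 // u2 // e1.
have L6 : var s6 vL = var s vL by rewrite v6 // u2 // e1.
have B6 : var s6 vB = B by rewrite v6 // u2 // e1 /= addn1.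
have c6 : var s6 vcap = var s vcap by rewrite v6 // u2 // e1.
have r6 : ready s6 by rewrite /ready S6 n6 L6 B6 c6.
clearbody s3 s4 s5 s6; rewrite sem_unwritten // S6; split=> //.
have := @sem_loop inp (fun j y =>
  var y vp = 5 + (var s vT - j) * (var s vn * var s vn) /\
  forall f, f < B ^ var s vn -> tab y f = value (var s vn) B (var s vL) (var s
    vT) j f)
  (Var vT) time_code s6.
rewrite /= T6 c6 p6 => /(_ Tc) [].
- by rewrite subn0; split=> // f _; rewrite t6.
- move=> j y jT fr _ [yp ytab].
  have f2 x : x <= vsq -> var y x = var s6 x.
    by case: x => [|[|[|[|[|[|[|x]]]]]]] // _; rewrite fr.
  have ry : ready y by apply: (ready_ext r6) => x xS; apply: f2; lia.
  have [-> ht] := time_step inp ry.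
  have pS : 5 + (var s vT - j) * (var s vn * var s vn) - var s vn * var s vn
      = 5 + (var s vT - j.+1) * (var s vn * var s vn).
    have -> : var s vT - j = (var s vT - j.+1).+1 by lia.
    by rewrite mulSn addnCA addKn.
  rewrite yp (f2 vsq) // sq6 pS; split=> // f fS.
  rewrite ht; last by rewrite f2 ?S6.
  rewrite yp !f2 // n6 B6 L6 sq6 pS.
  by apply: eq_best_value => a af; rewrite ytab //; lia.
by move=> _ h f fS; rewrite h.
Qed.


Ltac unwritten := repeat (rewrite sem_unwritten; last by []).

Lemma params_code_correct s :
  let n := var s vn in let T := var s vT in let C := var s vcap in
  let K := minn (nth 0 inp 2) T * (minn (nth 0 inp 3) T).+1 in
  let t := minn (nth 0 inp 4) (n * T).+1 in
  let s' := sem inp params_code s in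
  (n * T).+1 <= C -> n <= C -> T <= C ->
  [/\ [/\ var s' vn = n, var s' vT = T, var s' vnT = n * T & var s' vt = t],
      [/\ var s' vL = (minn (nth 0 inp 3) T).+1, var s' vK = K &
          var s' vq = n * minn K T] & var s' vbig = C * 2 ^ t].
Proof.
move=> n T C K t s' nTC nC TC.
have s'E : s' = sem inp params_code s by [].
move: s' s'E; rewrite /params_code 13!sem_seq.
set s1 := sem _ _ s; set s2 := sem _ _ s1; set s3 := sem _ _ s2.
set s4 := sem _ _ s3; set s5 := sem _ _ s4; set s6 := sem _ _ s5.
set s7 := sem _ _ s6; set s8 := sem _ _ s7; set s9 := sem _ _ s8.
set s10 := sem _ _ s9; set s11 := sem _ _ s10; set s12 := sem _ _ s11.
set s13 := sem _ _ s12 => s' ->.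
have k1 : var s1 vk = minn (nth 0 inp 2) T by rewrite /s1 var_assign /= -/T;
  lia.
have L2 : var s2 vL = (minn (nth 0 inp 3) T).+1.
  have T1 : var s1 vT = T by rewrite /s1; unwritten.
  by rewrite /s2 var_assign /= T1; lia.
have K4 : var s4 vK = K.
  have k3 : var s3 vk = minn (nth 0 inp 2) T by rewrite /s3 /s2; unwritten.
  have L3 : var s3 vL = (minn (nth 0 inp 3) T).+1 by rewrite /s3; unwritten.
  have c3 : var s3 vcap = C by rewrite /s3 /s2 /s1; unwritten.
  by rewrite /s4 sem_addmul //= k3 ?c3 ?L3 /s3 ?var_assign //=; lia.
have n4 : var s4 vn = n by rewrite /s4 /s3 /s2 /s1; unwritten.
have T4 : var s4 vT = T by rewrite /s4 /s3 /s2 /s1; unwritten.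
have c4 : var s4 vcap = C by rewrite /s4 /s3 /s2 /s1; unwritten.
have L4 : var s4 vL = (minn (nth 0 inp 3) T).+1 by rewrite /s4 /s3; unwritten.
clearbody s4.
have n5 : var s5 vn = n by rewrite /s5; unwritten.
have T5 : var s5 vT = T by rewrite /s5; unwritten.
have c5 : var s5 vcap = C by rewrite /s5; unwritten.
have nT6 : var s6 vnT = n * T.
  by rewrite /s6 sem_addmul //= n5 ?c5 // T5 /s5 var_assign.
have t7 : var s7 vt = t by rewrite /s7 var_assign /= nT6 /t; lia.
have z8 : var s8 vz = minn K T.
  have T7 : var s7 vT = T by rewrite /s7 /s6; unwritten.
  have K7 : var s7 vK = K by rewrite /s7 /s6 /s5; unwritten.
  by rewrite /s8 var_assign /= T7 K7; lia.
have q10 : var s10 vq = n * minn K T.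
  have n9 : var s9 vn = n by rewrite /s9 /s8 /s7 /s6; unwritten.
  have c9 : var s9 vcap = C by rewrite /s9 /s8 /s7 /s6; unwritten.
  have z9 : var s9 vz = minn K T by rewrite /s9; unwritten.
  by rewrite /s10 sem_addmul //= n9 ?c9 // z9 /s9 var_assign.
have t11 : var s11 vt = t by rewrite /s11 /s10 /s9 /s8; unwritten.
have c11 : var s11 vcap = C by rewrite /s11 /s10 /s9 /s8 /s7 /s6; unwritten.
have D12 : var s12 vD = 2 ^ t.
  have := @sem_loop inp (fun j y => var y vD = 2 ^ j) (Var vt)
    (Assign vD (Plus (Var vD) (Var vD))) s11.
  rewrite /= t11 c11; apply.
  - by apply: leq_trans nTC; rewrite geq_minr.
  - by rewrite /s11 var_assign.
  - by move=> j y _ _ _ yD; rewrite var_assign /= yD expnS mul2n addnn.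
have c13 : var s13 vcap = C by rewrite /s13 /s12; unwritten.
have D13 : var s13 vD = 2 ^ t by rewrite /s13; unwritten.
split; [split | split | ].
- by rewrite /s13 /s12 /s11 /s10 /s9 /s8 /s7 /s6; unwritten.
- by rewrite /s13 /s12 /s11 /s10 /s9 /s8 /s7 /s6; unwritten.
- by rewrite /s13 /s12 /s11 /s10 /s9 /s8 /s7; unwritten.
- by rewrite /s13 /s12; unwritten.
- by rewrite /s13 /s12 /s11 /s10 /s9 /s8 /s7 /s6 /s5; unwritten.
- by rewrite /s13 /s12 /s11 /s10 /s9 /s8 /s7 /s6 /s5; unwritten.
- by rewrite /s13 /s12 /s11; unwritten.
- by rewrite sem_addmul //= c13 // D13 /s13 var_assign.
Qed.

Definition init : state := State (fun=> 0) (fun=> 0).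

Lemma pow_states_bound n K t : n * K <= t -> K.+1 ^ n <= 2 ^ t.
Proof.
move=> nKt; apply: leq_trans (_ : 2 ^ (n * K) <= _); last by rewrite leq_exp2l.
by rewrite mulnC expnM; case: n {nKt} => // n; rewrite leq_exp2r // ltn_expl.
Qed.

Lemma main_code_correct :
  let n := nth 0 inp 0 in let T := nth 0 inp 1 in
  let k := nth 0 inp 2 in let l := nth 0 inp 3 in let t := nth 0 inp 4 in
  let L := (minn l T).+1 in let K := minn k T * L in
  let out := var (sem inp main_code init) vout in
  [/\ t <= n * minn K T -> out != 0,
      n * T < t -> out = 0 &
      n * minn K T < t -> t <= n * T ->
      (out != 0) = (t <= value n K.+1 L T T (K.+1 ^ n - 1))].
Proof.
move=> n T k l t L K out.
have outE : out = var (sem inp main_code init) vout by [].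
move: out outE; rewrite /main_code 7!sem_seq.
set s1 := sem _ _ init; set s2 := sem _ _ s1; set s3 := sem _ _ s2.
set s4 := sem _ _ s3; set s5 := sem _ _ s4; set s6 := sem _ _ s5.
set s7 := sem _ _ s6 => out outE.
set N := n + T + 1.
have n2 : var s2 vn = n by rewrite /s2 /s1 /sizes_code sem_seq !var_assign.
have T2 : var s2 vT = T by rewrite /s2 /s1 /sizes_code sem_seq !var_assign.
have c2 : var s2 vcap = N.
  by rewrite /s2 /s1 /sizes_code sem_seq !var_assign /= !var_assign.
have t2 : tab s2 = fun=> 0 by rewrite /s2 tab_assign /s1 sem_tab.
clearbody s2.
have sq3 : var s3 vsq = N * N.
  by rewrite /s3 /square_code sem_seq sem_addmul //= !var_assign /= c2.
have n4 : var s4 vn = n by rewrite /s4 /s3; unwritten.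
have T4 : var s4 vT = T by rewrite /s4 /s3; unwritten.
have c4 : var s4 vcap = N * N by rewrite /s4 var_assign.
have t4 : tab s4 = fun=> 0 by rewrite /s4 tab_assign /s3 sem_tab.
clearbody s3 s4.
have := @params_code_correct s4; cbv zeta;
  rewrite n4 T4 c4 -/k -/l -/t -/L -/K -/s5.
have nTN : (n * T).+1 <= N * N by rewrite /N; nia.
have nN : n <= N * N by rewrite /N; nia.
have TN : T <= N * N by rewrite /N; nia.
set tt := minn t _; move=> [] // [n5 T5 nT5 t5] [L5 K5 q5] big5.
have tab5 : tab s5 = fun=> 0 by rewrite /s5 sem_tab.
have v6 x : x != vcap -> var s6 x = var s5 x.
  by rewrite /s6 var_assign => /negbTE ->.
have c6 : var s6 vcap = N * N * 2 ^ tt by rewrite /s6 var_assign.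
have tab6 : tab s6 = fun=> 0 by rewrite /s6 tab_assign.
clearbody s5 s6.
have c7 : var s7 vcap = N * N * 2 ^ tt by rewrite /s7; unwritten.
have N0 : 0 < N by rewrite /N addn1.
have cap_gt0 : 0 < N * N * 2 ^ tt by rewrite !muln_gt0 expn_gt0 N0.
have nT7 : var s7 vnT = n * T by rewrite /s7; unwritten; rewrite v6.
have t7 : var s7 vt = tt by rewrite /s7; unwritten; rewrite v6.
have q7 : var s7 vq = n * minn K T by rewrite /s7; unwritten; rewrite v6.
have {}outE : out = (n * minn K T + 1 - tt) + if n * T + 1 - tt == 0 then 0
    else tab s7 (var s7 vS - 1) + 1 - tt.
  rewrite outE /answer_code sem_seq sem_ifnz; last by rewrite var_assign /= c7.
  rewrite /= !var_assign /= nT7 t7.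
  by case: ifP => _; rewrite ?var_assign /= ?var_assign /= ?tab_assign q7 t7
    ?addn0.
have qn : n * minn K T <= n * T by rewrite leq_mul2l geq_minr orbT.
split.
- by move=> tq; rewrite outE /tt; case: ifP; lia.
- by move=> nTt; rewrite outE /tt ifT; lia.
move=> qt tn.
have ttE : tt = t by rewrite /tt; lia.
(* Otherwise min(K, T) = T and the two bounds on t contradict each other. This makes n K < t, so the
   states fit under the cap, and the base K + 1 is at most T. *)
have KT : K < T.
  rewrite ltnNge; apply/negP => TK; move: qt; rewrite (minn_idPr TK); lia.
have nK : n * K < t by move: qt; rewrite (minn_idPl (ltnW KT)).
have [S7 tab7] : var s7 vS = K.+1 ^ n /\ forall f, f < K.+1 ^ n ->
    tab s7 f = value n K.+1 L T T f.
  have := @dp_code_correct s6; cbv zeta; rewrite c6 !v6 // K5 n5 T5 L5 -/s7;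
    apply=> //.
  - by apply: leq_trans nN _; rewrite leq_pmulr // expn_gt0.
  - by apply: leq_trans TN _; rewrite leq_pmulr // expn_gt0.
  - apply: leq_trans KT _; apply: leq_trans TN _.
    by rewrite leq_pmulr // expn_gt0.
  - apply: leq_trans (_ : 2 ^ tt <= _);
      last by rewrite leq_pmull // muln_gt0 N0.
    by apply: pow_states_bound; rewrite ttE ltnW.
  - by move=> a; rewrite tab6.
rewrite outE S7 ifF; last by lia.
have S0 : 0 < K.+1 ^ n by rewrite expn_gt0.
rewrite tab7; last by lia.
move: qt; rewrite ttE; lia.
Qed.

(** [cost_poly] does not reach across an assignment to the cap, so the time is estimated separately
    on the stretches between such assignments. These are the caps in force there. *)
Lemma caps :
  let N := nth 0 inp 0 + nth 0 inp 1 + 1 in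
  let s2 := sem inp (Assign vcap (Plus (Plus (Var vn) (Var vT)) (Lit 1)))
              (sem inp sizes_code init) in
  let s4 := sem inp (Assign vcap (Var vsq)) (sem inp square_code s2) in
  let s6 := sem inp (Assign vcap (Var vbig)) (sem inp params_code s4) in
  [/\ var s2 vcap = N, var s4 vcap = N * N &
      var s6 vcap <= N * N * 2 ^ nth 0 inp 4].
Proof.
set n := nth 0 inp 0; set T := nth 0 inp 1; move=> N s2 s4 s6.
have n2 : var s2 vn = n by rewrite /s2 /sizes_code sem_seq !var_assign.
have T2 : var s2 vT = T by rewrite /s2 /sizes_code sem_seq !var_assign.
have c2 : var s2 vcap = N.
  by rewrite /s2 /sizes_code sem_seq !var_assign /= !var_assign.
have c4 : var s4 vcap = N * N.
  by rewrite /s4 var_assign /= /square_code sem_seq sem_addmul //= !var_assign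
    /= c2.
split=> //.
have n4 : var s4 vn = n by rewrite /s4; unwritten.
have T4 : var s4 vT = T by rewrite /s4; unwritten.
rewrite /s6 var_assign /=; clearbody s4.
have := @params_code_correct s4; cbv zeta; rewrite n4 T4 c4.
have nTN : (n * T).+1 <= N * N by rewrite /N; nia.
have nN : n <= N * N by rewrite /N; nia.
have TN : T <= N * N by rewrite /N; nia.
move=> /(_ nTN nN TN) [_ _ ->].
by rewrite leq_mul2l leq_exp2l // geq_minl orbT.
Qed.

End Main.

Lemma cost_seq inp c1 c2 s :
  cost inp (Seq c1 c2) s = cost inp c1 s + cost inp c2 (sem inp c1 s).
Proof. by []. Qed.

(** The factor 2 absorbs the + 1 that [cost_poly] adds to the cap. *)
Lemma cost_main_code : exists A, forall inp,
  cost inp main_code init <=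
  A * (2 * ((nth 0 inp 0 + nth 0 inp 1 + 1) ^ 2 * 2 ^ nth 0 inp 4)) ^ A.
Proof.
have [A1 H1] := cost_poly (c := sizes_code) isT.
have [A2 H2] := cost_poly (c := square_code) isT.
have [A3 H3] := cost_poly (c := params_code) isT.
have [A4 H4] := cost_poly (c := Seq dp_code answer_code) isT.
pose w e := size (compile_expr e 0) + 2.
pose w0 := w (Plus (Plus (Var vn) (Var vT)) (Lit 1)) + w (Var vsq) + w (Var
  vbig).
exists (A1 + A2 + A3 + A4 + w0) => inp; set N := _ + _ + 1; set M := 2 * _.
have [c2 c4 c6] := caps inp.
have N1 : 1 <= N by rewrite /N addn1.
have D1 : 1 <= 2 ^ nth 0 inp 4 by rewrite expn_gt0.
have step A X E : X < M -> A <= E -> A * X.+1 ^ A <= A * M ^ E.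
  move=> XM AE; rewrite leq_mul2l; apply/orP; right.
  apply: leq_trans (_ : M ^ A <= _).
    by case: (A) => // a; rewrite leq_exp2r.
  by apply: leq_pexp2l => //; apply: leq_ltn_trans XM.
rewrite /main_code 6!cost_seq; move: c2 c4 c6.
set s1 := sem _ _ init; set s2 := sem _ _ s1; set s3 := sem _ _ s2.
set s4 := sem _ _ s3; set s5 := sem _ _ s4; set s6 := sem _ _ s5.
rewrite -/N => c2 c4 c6.
have M0 : 0 < M by rewrite /M muln_gt0 muln_gt0 expn_gt0 N1.
have M6 : N * N * 2 ^ nth 0 inp 4 < M by rewrite /M -mulnn; nia.
have M4 : N * N < M by apply: leq_ltn_trans M6; rewrite leq_pmulr.
have M2 : N < M by apply: leq_ltn_trans M4; rewrite leq_pmulr.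
set E := A1 + _ + _ + _ + _.
have h1 : cost inp sizes_code init <= A1 * M ^ E.
  by apply: leq_trans (H1 inp init) _; apply: step => //; rewrite /E; lia.
have h2 : cost inp square_code s2 <= A2 * M ^ E.
  by apply: leq_trans (H2 inp s2) _; apply: step; rewrite ?c2 // /E; lia.
have h3 : cost inp params_code s4 <= A3 * M ^ E.
  by apply: leq_trans (H3 inp s4) _; apply: step; rewrite ?c4 // /E; lia.
have h4 : cost inp (Seq dp_code answer_code) s6 <= A4 * M ^ E.
  apply: leq_trans (H4 inp s6) _; apply: step; last by rewrite /E; lia.
  exact: leq_ltn_trans M6.
have ME : 0 < M ^ E by rewrite expn_gt0 M0.
have h0 : w0 <= w0 * M ^ E by rewrite leq_pmulr.
have e1 : cost inp (Assign vcap (Plus (Plus (Var vn) (Var vT)) (Lit 1))) s1 +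
  cost inp (Assign vcap (Var vsq)) s3 + cost inp (Assign vcap (Var vbig)) s5 =
    w0 by [].
clearbody w0; rewrite {1}/E !mulnDl; move: h1 h2 h3 h4 h0 e1; clear.
move: (cost _ (Assign _ _) _) (cost _ (Assign _ _) _) (cost _ (Assign _ _) _).
move: (cost _ (Seq _ _) _) (cost _ _ s4) (cost _ _ s2) (cost _ _ init) (M ^ E).
by move=> *; lia.
Qed.

(** * Timelines and fuel *)

Section Runs.

Variable L : nat.
Hypothesis L0 : 0 < L.

Lemma ltn_predL : L.-1 < L. Proof. by rewrite prednK. Qed.

(** The quotient of the fuel by [L] counts the intervals not yet started, and the remainder the time
    steps still owed to the interval in progress. *)
Definition is_run (T : nat) (fuel : nat -> nat) (act : nat -> bool) : Prop :=
  forall i, i < T -> [/\ act i -> 0 < fuel i, ~~ act i -> L %| fuel i &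
                         fuel i.+1 = fuel i - act i].

Definition starts (fuel : nat -> nat) (act : nat -> bool) (i : nat) : bool :=
  act i && (L %| fuel i).

Lemma divmod_start f : 0 < f -> L %| f ->
  f %/ L = (f.-1 %/ L).+1 /\ (f.-1 %% L).+1 = L.
Proof.
move=> f0 /dvdnP[[|q] fE]; first by lia.
have -> : f.-1 = q * L + L.-1 by rewrite fE mulSn; lia.
rewrite fE mulnK // divnMDl // modnMDl.
by rewrite divn_small ?modn_small ?ltn_predL ?addn0 ?prednK.
Qed.

Lemma divmod_mid f : ~~ (L %| f) ->
  f.-1 %/ L = f %/ L /\ (f.-1 %% L).+1 = f %% L.
Proof.
move=> nd; have r0 : 0 < f %% L by rewrite lt0n.
have fE : f.-1 = f %/ L * L + (f %% L).-1
  by rewrite {1}(divn_eq f L) -!subn1 addnBA.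
have lt : (f %% L).-1 < L by have := ltn_pmod f L0; lia.
by rewrite fE divnMDl // modnMDl (divn_small lt) (modn_small lt) addn0 prednK.
Qed.

(** The quotient of the fuel by [L] is a potential: it drops by one at each start and stays constant
    otherwise. *)
Lemma run_starts T fuel act k : is_run T fuel act -> fuel 0 = k * L ->
  \sum_(a < T) starts fuel act a <= k.
Proof.
move=> run f0.
suff H : forall j, j <= T -> \sum_(a < j) starts fuel act a + fuel j %/ L <= k.
  by apply: leq_trans (H T (leqnn T)); apply: leq_addr.
elim=> [_|j IH jT]; first by rewrite big_ord0 f0 mulnK.
rewrite big_ord_recr /=; have [h1 h2 ->] := run j jT.
apply: leq_trans (IH (ltnW jT)); rewrite -addnA leq_add2l /starts.
case: (act j) h1 h2 => /= [/(_ isT) p _|_ _]; last by rewrite subn0.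
rewrite subn1; case: (boolP (L %| _)) => d.
  by have [-> _] := divmod_start p d; rewrite add1n.
by have [-> _] := divmod_mid d.
Qed.

Lemma run_covered T fuel act k : is_run T fuel act -> fuel 0 = k * L ->
  forall i, i < T -> act i ->
  exists a, [/\ a <= i, i < a + L & starts fuel act a].
Proof.
move=> run f0.
(* A nonzero remainder remembers the start [a] of the interval in progress: that interval ends just
   before time j + fuel j %% L, which is therefore a + L. *)
have H : forall j, j <= T -> ~~ (L %| fuel j) ->
    exists a, [/\ a < j, j + fuel j %% L = a + L & starts fuel act a].
  elim=> [_|j IH jT]; first by rewrite f0 dvdn_mull.
  have [h1 h2 ->] := run j jT.
  case: (boolP (act j)) => aj; last by rewrite subn0 h2.
  have p := h1 aj.
  rewrite subn1; case: (boolP (L %| fuel j)) => d _.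
    have [_ m] := divmod_start p d.
    by exists j; rewrite /starts aj d; split=> //; rewrite -{2}m; lia.
  have [a [aj' e s]] := IH (ltnW jT) d; have [_ m] := divmod_mid d.
  by exists a; split=> //; lia.
move=> i iT ai; case: (boolP (L %| fuel i)) => d.
  by exists i; rewrite /starts ai d; split=> //; lia.
have [a [h1 h2 h3]] := H i (ltnW iT) d.
have r0 : 0 < fuel i %% L by rewrite lt0n.
by exists a; split=> //; lia.
Qed.

End Runs.

Section Timelines.

Variables (V : finType) (T : nat).
Local Notation interval := (V * 'I_T * 'I_T)%type.

Lemma timeline_of_runs (k L : nat) (fuel : V -> nat -> nat)
    (act : V -> nat -> bool) : 0 < L ->
  (forall v, is_run L T (fuel v) (act v)) -> (forall v, fuel v 0 = k * L) ->
  exists2 S : {set interval}, is_timeline k L.-1 S &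
    forall v (i : 'I_T), act v i -> active S v i.
Proof.
move=> L0 run f0.
(* One interval per start, of full length unless the end of time cuts it off. The start determines
   it, so counting starts bounds the number of intervals per vertex. *)
pose S := [set x : interval | starts L (fuel (ivertex x)) (act (ivertex x))
  (istart x)
  && (iend x == minn (istart x + L.-1) T.-1 :> nat)].
exists S.
  apply/andP; split.
    apply/forall_inP => x; rewrite inE => /andP[_ /eqP ->].
    by have := ltn_ord (istart x); lia.
  apply/forallP => v; apply: leq_trans (run_starts L0 (run v) (f0 v)).
  rewrite -(big_mkcond (fun a : 'I_T => starts L (fuel v) (act v) a) (fun=> 1))
    sum1_card.
  set A := [set x in S | _].
  have inj : {in A &, injective (@istart V T)}.
    move=> [[v1 a1] b1] [[v2 a2] b2];
      rewrite !inE /= => /andP[/andP[_ /eqP e1] /eqP h1].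
    move=> /andP[/andP[_ /eqP e2] /eqP h2] ea.
    rewrite /istart /iend /ivertex /= in e1 e2 h1 h2 ea.
    subst; congr (_, _); apply: val_inj; rewrite /= e1 e2 //.
  rewrite -(card_in_imset inj); apply: subset_leq_card; apply/subsetP => a.
  by case/imsetP => x; rewrite !inE => /andP[/andP[h _] /eqP <-] ->.
move=> v i ai.
have [a [ai' iaL st]] := run_covered L0 (run v) (f0 v) (ltn_ord i) ai.
have aT : a < T by apply: leq_ltn_trans (ltn_ord i).
have bT : minn (a + L.-1) T.-1 < T by have := ltn_ord i; lia.
apply/existsP; exists (v, Ordinal aT, Ordinal bT).
rewrite inE /ivertex /istart /iend /= st !eqxx ai' /=.
by have := ltn_ord i; lia.
Qed.

Lemma timelineW (k l k' l' : nat) (S : {set interval}) :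
  k <= k' -> l <= l' -> is_timeline k l S -> is_timeline k' l' S.
Proof.
move=> kk ll /andP[/forall_inP h1 /forallP h2]; apply/andP; split.
  apply/forall_inP => x /h1 /andP[-> h] /=; exact: leq_trans ll.
by apply/forallP => v; apply: leq_trans (h2 v) kk.
Qed.

(* The greedy run follows the timeline: it starts an interval whenever the
   timeline is active and no interval is in progress. *)
Section Greedy.

Variables (k l : nat) (S : {set interval}) (v : V).
Hypothesis tl : is_timeline k l S.

Definition live (i : nat) : bool :=
  [exists x in S, [&& ivertex x == v, istart x <= i & i <= iend x]].

Definition greedy_act (f i : nat) : bool :=
  ~~ (l.+1 %| f) || (live i && (0 < f)).

Fixpoint greedy_fuel (i : nat) : nat :=
  if i is i'.+1 then greedy_fuel i' - greedy_act (greedy_fuel i') i'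
  else k * l.+1.

Lemma greedy_run :
  is_run l.+1 T greedy_fuel (fun i => greedy_act (greedy_fuel i) i).
Proof.
move=> i _; rewrite /greedy_act; split=> //.
- by case/orP => [|/andP[]] //; case: (greedy_fuel i).
- by rewrite negb_or negbK => /andP[].
Qed.

Lemma greedy_fuel_le i : greedy_fuel i <= k * l.+1.
Proof. by elim: i => //= i IH; apply: leq_trans IH; apply: leq_subr. Qed.

(** The time i + fuel mod (l + 1) is the first one after the greedy interval in progress. Intervals
    of the timeline that reach it may still need a greedy start, and enough starts must be left for
    all of them. *)
Lemma greedy_invariant i :
  #|[set x in S | (ivertex x == v) && (i + greedy_fuel i %% l.+1 <= iend x)]|
  <= greedy_fuel i %/ l.+1.
Proof.
have /andP[/forall_inP tl1 /forallP tl2] := tl.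
elim: i => [|i IH].
  rewrite /= modnMl mulnK //; apply: leq_trans (tl2 v).
  by apply: subset_leq_card; apply/subsetP => x;
    rewrite !inE => /andP[-> /andP[->]].
rewrite /= /greedy_act; case: (boolP (l.+1 %| greedy_fuel i)) => d /=;
  last first.
  rewrite subn1; have [-> m] := divmod_mid (ltn0Sn l) d.
  by have -> : i.+1 + (greedy_fuel i).-1 %% l.+1 = i + greedy_fuel i %% l.+1
    by lia.
case: (boolP (live i)) => [lv|nl] /=; last first.
  rewrite subn0; apply: leq_trans IH; apply: subset_leq_card.
  by apply/subsetP => x; rewrite !inE => /andP[-> /andP[-> h]] /=; lia.
case/existsP: lv => x /andP[xS /and3P[xv xi ix]].
move/eqP: (d) => m0; rewrite m0 addn0 in IH.
have xin : x \in [set x in S | (ivertex x == v) && (i <= iend x)].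
  by rewrite inE xS xv.
(* The live interval x is counted by the invariant, so the quotient cannot be 0. *)
have f0 : 0 < greedy_fuel i.
  case: (greedy_fuel i) IH => // h; move: h;
    rewrite div0n leqn0 cards_eq0 => /eqP E.
  by rewrite E inE in xin.
rewrite f0 subn1; have [e m] := divmod_start (ltn0Sn l) f0 d.
(* The start uses up one unit of the quotient, and x pays for it: x began at time i or before, so it
   ends by i + l, within the new greedy interval, and is no longer counted. *)
rewrite e (cardsD1 x) xin add1n ltnS in IH; apply: leq_trans IH.
apply: subset_leq_card; apply/subsetP => y;
  rewrite !inE => /andP[-> /andP[-> h]] /=.
have /andP[_ xl] := tl1 x xS.
have yi : i <= iend y by lia.
rewrite yi !andbT; apply/eqP => yx; move: h; rewrite yx; lia.
Qed.

Lemma greedy_covers (i : 'I_T) :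
  active S v i -> greedy_act (greedy_fuel i) i.
Proof.
move=> lv; rewrite /greedy_act; case: (boolP (l.+1 %| _)) => //= d.
have -> : live i by [].
case/existsP: lv => x /andP[xS /and3P[xv xi ix]] /=.
rewrite lt0n; apply/eqP => f0; have := greedy_invariant i.
rewrite f0 mod0n div0n addn0 leqn0 cards_eq0 => /eqP E.
have : x \in [set x in S | (ivertex x == v) && (i <= iend x)]
  by rewrite inE xS xv.
by rewrite E inE.
Qed.

End Greedy.
End Timelines.

(** * States as numbers in base K + 1 *)

Definition enc (B n : nat) (d : nat -> nat) : nat := \sum_(u < n) d u * B ^ u.

Lemma enc_recl B n d : enc B n.+1 d = d 0 + B * enc B n (fun u => d u.+1).
Proof.
rewrite /enc big_ord_recl muln1; congr (_ + _).
by rewrite big_distrr; apply: eq_bigr => u _; rewrite /= /bump /= expnS mulnCA.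
Qed.

Lemma digit_enc B n d v : 0 < B -> (forall u, d u < B) -> v < n ->
  digit B (enc B n d) v = d v.
Proof.
move=> B0; elim: v n d => [|v IH] [|n] d dB vn //; rewrite enc_recl /digit.
  by rewrite divn1 mulnC addnC modnMDl modn_small.
rewrite expnS divnMA mulnC addnC divnMDl // (divn_small (dB 0)) addn0.
exact: IH.
Qed.

Lemma enc_digit B n f : 0 < B -> f < B ^ n -> enc B n (digit B f) = f.
Proof.
move=> B0; elim: n f => [|n IH] f; first by rewrite /enc big_ord0; lia.
move=> fB; rewrite enc_recl {1}/digit divn1.
have -> : enc B n (fun u => digit B f u.+1) = enc B n (digit B (f %/ B)).
  by apply: eq_bigr => u _; rewrite /digit expnS divnMA.
by rewrite IH ?ltn_divLR -?expnSr // addnC mulnC -divn_eq.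
Qed.

Lemma enc_max K n : (enc K.+1 n (fun=> K)).+1 = K.+1 ^ n.
Proof.
elim: n => [|n IH]; first by rewrite /enc big_ord0.
by rewrite enc_recl expnS -IH; lia.
Qed.

Lemma enc_le B n d d' : (forall u, u < n -> d u <= d' u) -> enc B n d <= enc B
  n d'.
Proof. by move=> h; apply: leq_sum => u _; rewrite leq_mul2r h ?orbT. Qed.

Lemma enc_sub B n d d' : (forall u, u < n -> d' u <= d u) ->
  enc B n (fun u => d u - d' u) = enc B n d - enc B n d'.
Proof.
move=> h; have -> : enc B n d = enc B n (fun u => d u - d' u) + enc B n d'.
  rewrite /enc -big_split; apply: eq_bigr => u _ /=.
  by rewrite -mulnDl subnK // h.
by rewrite addnK.
Qed.

Lemma digit_lt B f u : 0 < B -> digit B f u < B.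
Proof. exact: ltn_pmod. Qed.

(** The digitwise inequality rules out borrows, so the differences of the digits are digits of the
    difference. *)
Lemma digit_sub B n f e u : 0 < B -> f < B ^ n -> e < B ^ n ->
  (forall v, v < n -> digit B e v <= digit B f v) -> u < n ->
  digit B (f - e) u = digit B f u - digit B e u.
Proof.
move=> B0 fB eB h un.
rewrite -{1}(enc_digit B0 fB) -{1}(enc_digit B0 eB) -enc_sub // digit_enc //.
by move=> v; apply: leq_ltn_trans (leq_subr _ _) (digit_lt _ _ B0).
Qed.

Lemma legalP n B L f e :
  reflect (forall u, u < n -> [/\ digit B e u <= 1, digit B e u <= digit B f u &
             digit B e u = 0 -> L %| digit B f u])
          (legal n B L f e).
Proof.
rewrite /legal sum_nat_eq0; apply: (iffP forallP) => [h u un|h u].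
  have := h (Ordinal un); rewrite /badness /= !addn_eq0 !subn_eq0.
  by case/andP => /andP[h1 h2] h3; split=> // e0; rewrite e0 eqxx in h3.
have [h1 h2 h3] := h u (ltn_ord u).
rewrite /badness /= !addn_eq0 !subn_eq0 h1 h2 /=.
by case: ifP => // /eqP /h3.
Qed.

(** * Optimal paths of the dynamic program *)

Section Paths.

Variables (inp : seq nat) (n B L T : nat).

Local Notation gain_at i e := (gain inp n B (5 + i * (n * n)) e).

Definition is_path (m : nat) (F es : nat -> nat) : Prop :=
  forall i, m <= i < T ->
  [/\ legal n B L (F i) (es i), es i <= F i & F i.+1 = F i - es i].

Lemma path_le_value F es : is_path 0 F es ->
  \sum_(0 <= i < T) gain_at i (es i) <= value inp n B L T T (F 0).
Proof.
move=> path; suff H : forall j, j <= T ->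
    \sum_(T - j <= i < T) gain_at i (es i) <= value inp n B L T j (F (T - j)).
  by have := H T (leqnn T); rewrite subnn.
elim=> [_|j IH jT]; first by rewrite subn0 big_geq.
have [|lg le FS] := path (T - j.+1); first by lia.
have e : T - j = (T - j.+1).+1 by lia.
rewrite big_ltn; last by lia.
rewrite /= /best_value.
apply: leq_trans (@leq_bigmax_cond _ _
  (fun x : 'I_(F (T - j.+1)).+1 => gain_at (T - j.+1) x + value inp n B L T j
    (F (T - j.+1) - x))
  (Ordinal (le : es (T - j.+1) < (F (T - j.+1)).+1)) lg).
rewrite /= leq_add2l -FS -e; exact: IH (ltnW jT).
Qed.

Hypothesis B0 : 0 < B.

(** Letting every vertex with fuel burn a unit is always legal. This keeps the maximum in
    [best_value] from ranging over the empty set, where its value 0 would have no witness. *)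
Lemma legal_exists f : f < B ^ n -> exists2 e, e <= f & legal n B L f e.
Proof.
move=> fB; pose d u : nat := digit B f u != 0.
have dB u : d u < B.
  by apply: leq_ltn_trans (digit_lt f u B0); rewrite /d; case: (digit B f u).
exists (enc B n d).
  rewrite -[X in _ <= X](enc_digit B0 fB); apply: enc_le => u _.
  by rewrite /d; case: (digit B f u).
apply/legalP => u un; rewrite digit_enc // /d.
by case: (digit B f u) => [|w] /=; split.
Qed.

(** Each maximum is attained, so following the maximizers from time T - j on yields a path that
    realizes the optimum. *)
Lemma value_path j f : j <= T -> f < B ^ n ->
  exists F es, [/\ F (T - j) = f, is_path (T - j) F es &
    value inp n B L T j f = \sum_(T - j <= i < T) gain_at i (es i)].
Proof.
elim: j f => [|j IH] f jT fB.
  exists (fun=> f), (fun=> 0); split=> //; first by move=> i; lia.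
  by rewrite subn0 big_geq.
have [e0 ef0 lg0] := legal_exists fB.
have := @eq_bigmax_cond _ (fun x : 'I_f.+1 => legal n B L f x)
  (fun x : 'I_f.+1 => gain_at (T - j.+1) x + value inp n B L T j (f - x)).
case.
  by apply/card_gt0P; exists (Ordinal (ef0 : e0 < f.+1)).
move=> e lg E; have [||F [es [F0 path V]]] := IH (f - e).
- exact: ltnW.
- exact: leq_ltn_trans (leq_subr _ _) fB.
have eT : T - j = (T - j.+1).+1 by lia.
exists (fun i => if i == T - j.+1 then f else F i), (fun i => if i == T - j.+1
  then val e else es i).
split; first by rewrite eqxx.
  move=> i /andP[h1 h2]; case: eqP => [->|ne].
    rewrite ifF; last by lia.
    by rewrite -eT F0; split=> //; apply: (ltn_ord e).
  rewrite ifF; last by lia.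
  by apply: path; lia.
rewrite big_ltn ?eqxx; last by lia.
rewrite [LHS]E V -eT; congr (_ + _); apply: eq_big_nat => i hi.
by rewrite ifF //; lia.
Qed.

End Paths.

(** * Correctness *)

Section Encoding.

Variables (V : finType) (T : nat) (G : temporal_graph V T) (k l t : nat).
Local Notation n := #|V|.
Local Notation inp := (encode G k l t).

Lemma nth_flatten_const (A : Type) (x0 : A) (m : nat) (ss : seq (seq A)) i j :
  all (fun s => size s == m) ss -> j < m -> i < size ss ->
  nth x0 (flatten ss) (i * m + j) = nth x0 (nth [::] ss i) j.
Proof.
elim: ss i => // s ss IH [|i] /= /andP[/eqP sm h] jm ilt; rewrite nth_cat sm.
  by rewrite jm.
by rewrite mulSn -addnA ltnNge leq_addr /= addKn IH.
Qed.

Lemma nth_encode (i : 'I_T) (u v : V) :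
  nth 0 inp (5 + i * (n * n) + enum_rank v + enum_rank u * n) =
  adj (tnth G i) u v.
Proof.
have sz g : size [seq (adj g u v : nat) | u <- enum V, v <- enum V] = n * n.
  by rewrite size_allpairs -cardE.
rewrite -!addnA /encode nth_cat ltnNge leq_addr /= addKn.
have un := ltn_ord (enum_rank u); have vn := ltn_ord (enum_rank v).
have uv : enum_rank v + enum_rank u * n < n * n.
  apply: leq_trans (_ : n + enum_rank u * n <= _); first by rewrite ltn_add2r.
  by rewrite -mulSn leq_mul2r un orbT.
rewrite nth_flatten_const //; first last.
- by rewrite size_map size_tuple.
- by elim: (val G) => //= g s ->; rewrite sz eqxx.
rewrite (nth_map (tnth G i)) ?size_tuple // -tnth_nth addnC.
have szV : size (enum V) = n by rewrite -cardE.
rewrite nth_flatten_const //; first last.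
- by rewrite size_map szV.
- by apply/allP => s /mapP[x _ ->]; rewrite size_map szV.
by rewrite (nth_map u) ?szV // nth_enum_rank (nth_map v) ?szV // nth_enum_rank.
Qed.

Lemma gain_encode (B e : nat) (i : 'I_T) :
  gain inp n B (5 + i * (n * n)) e =
  #|[set v : V | [exists u, (digit B e (enum_rank u) != 0) &&
                            (v \in closed_nbh (tnth G i) u)]]|.
Proof.
rewrite /gain -sum1dep_card [RHS]big_mkcond /=.
rewrite (reindex (@enum_rank V)) /=; last first.
  by apply: onW_bij; apply: enum_rank_bij.
apply: eq_bigr => v _; set b := [exists u, _].
suff -> : (dom_count inp n B (5 + i * (n * n)) e (enum_rank v) != 0) = b
  by case: b.
rewrite /dom_count sum_nat_eq0; apply/idP/idP.
  rewrite negb_forall => /existsP[u0]; rewrite -(enum_valK u0);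
    set u := enum_val u0.
  rewrite implyTb; case: ifP => // /negbT d; rewrite nth_encode => h.
  apply/existsP; exists u; rewrite d inE /=.
  case: (adj _ u v) h => //=; first by rewrite orbT.
  by rewrite orbF (inj_eq val_inj) (inj_eq enum_rank_inj) [v == u]eq_sym;
    case: (u == v).
case/existsP => u /andP[d]; rewrite inE => h.
rewrite negb_forall; apply/existsP; exists (enum_rank u).
rewrite implyTb (negbTE d) nth_encode (inj_eq val_inj) (inj_eq enum_rank_inj)
  [u == v]eq_sym.
by case/orP: h => ->; rewrite ?addn1 ?add1n.
Qed.

Lemma card_dominated (S : {set V * 'I_T * 'I_T}) :
  #|dominated G S| = \sum_(i < T) #|[set v | dominates G S v i]|.
Proof.
rewrite -sum1dep_card (eq_bigr (fun i : 'I_T => \sum_(v : V | dominates G S v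
  i) 1)).
  by rewrite pair_big_dep /= (reindex (fun p : V * 'I_T => (p.2, p.1))) //=;
     exists (fun p => (p.2, p.1)) => -[].
by move=> i _; rewrite sum1dep_card.
Qed.

Lemma dominated_le (S : {set V * 'I_T * 'I_T}) : #|dominated G S| <= n * T.
Proof. by apply: leq_trans (max_card _) _; rewrite card_prod card_ord. Qed.

(** All vertices behave alike: active from the beginning until the fuel is gone. Counting only that
    each active vertex dominates itself is enough. *)
Lemma saturated_yes (L : nat) : 0 < L -> L <= l.+1 ->
  t <= n * minn (minn k T * L) T -> timeline_partial_dominating_set G k l t.
Proof.
move=> L0 Ll tn; set kk := minn k T in tn *; pose K := kk * L.
have [||S tl act] := @timeline_of_runs V T kk L (fun _ i => K - i) (fun _ i =>
  i < K) L0.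
- move=> v i iT; split; first by rewrite subn_gt0.
    by rewrite -leqNgt => h; rewrite (eqP (h : K - i == 0)) dvdn0.
  by case: ltnP => h; lia.
- by move=> v; rewrite subn0.
apply/existsP; exists S; apply/andP; split.
  by apply: timelineW tl; rewrite ?geq_minl //; lia.
apply: leq_trans tn _; rewrite card_dominated.
apply: leq_trans (_ : \sum_(i < T) (if i < K then n else 0) <= _); last first.
  apply: leq_sum => i _; case: ifP => // iK.
  rewrite -cardsT; apply: subset_leq_card; apply/subsetP => v _; rewrite inE.
  by apply/existsP; exists v; rewrite inE eqxx /= andbT; apply: act.
rewrite -big_mkcond sum_nat_const mulnC leq_mul2r; apply/orP; right.
have le : minn K T <= T by rewrite geq_minr.
pose h (j : 'I_(minn K T)) := widen_ord le j.
have hi : injective h by move=> a b /(congr1 val) /= /val_inj.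
rewrite -[X in X <= _]card_ord -(card_imset _ hi); apply: subset_leq_card.
by apply/subsetP => _ /imsetP[j _ ->]; rewrite unfold_in /=; have := ltn_ord j;
  lia.
Qed.

(** A timeline gives greedy runs, whose fuel and activity vectors form a path of the dynamic
    program; conversely the digits of an optimal path are runs, which yield a timeline. In both
    directions activity can only grow, hence domination too. *)
Lemma value_timeline (K := k * l.+1) :
  timeline_partial_dominating_set G k l t =
  (t <= value inp n K.+1 l.+1 T T (K.+1 ^ n - 1)).
Proof.
have full : K.+1 ^ n - 1 = enc K.+1 n (fun=> K) by rewrite -enc_max subn1.
have fB : K.+1 ^ n - 1 < K.+1 ^ n by rewrite subn1 prednK // expn_gt0.
apply/idP/idP.
  case/existsP => S /andP[tl tS]; apply: leq_trans tS _.
  (* Vertices become numbers below n. The default values for other numbers only have to be less than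
     K + 1, because [digit_enc] asks this of every index. *)
  pose fuel (u i : nat) := if insub u is Some u' then greedy_fuel k l S
    (enum_val (u' : 'I_n)) i else K.
  pose act (u i : nat) : bool := if insub u is Some u' then
     greedy_act l S (enum_val (u' : 'I_n)) (fuel u i) i else false.
  have fuelE (u : 'I_n) i : fuel u i = greedy_fuel k l S (enum_val u) i.
    by rewrite /fuel valK.
  have actE (u : 'I_n) i : act u i = greedy_act l S (enum_val u) (greedy_fuel k
    l S (enum_val u) i) i.
    by rewrite /act valK fuelE.
  have fK u i : fuel u i < K.+1.
    by rewrite ltnS /fuel; case: insub => // u'; apply: greedy_fuel_le.
  have run (u : 'I_n) := greedy_run k l S (enum_val u).
  have aK u i : i < T -> act u i < K.+1.
    move=> iT; apply: leq_ltn_trans (fK u i).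
    rewrite /act /fuel; case: insubP => // u' _ _.
    by have [h _ _] := run u' i iT; case: greedy_act h => // ->.
  pose F i := enc K.+1 n (fun u => fuel u i).
  pose es i := enc K.+1 n (fun u => act u i : nat).
  have a_le (u : 'I_n) i : i < T -> act u i <= fuel u i.
    move=> iT; rewrite actE fuelE; have [h _ _] := run u i iT.
    by case: greedy_act h => // ->.
  have path : is_path n K.+1 l.+1 T 0 F es.
    move=> i iT; split.
    - apply/legalP => u un; rewrite !digit_enc // => [|v]; last exact: aK.
      have := a_le (Ordinal un) i iT; rewrite /= => le.
      split=> //; first by case: (act u i).
      have -> : u = Ordinal un by [].
      rewrite actE fuelE; have [_ h _] := run (Ordinal un) i iT.
      by case: greedy_act h => // h _; apply: h.
    - by apply: enc_le => u un; apply: (a_le (Ordinal un)).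
    - rewrite /F /es -enc_sub; last by move=> u un; apply: (a_le (Ordinal un)).
      apply: eq_bigr => u _; congr (_ * _); rewrite actE !fuelE.
      by have [_ _ ->] := run u i iT.
  have := path_le_value inp path.
  have -> : F 0 = K.+1 ^ n - 1.
    rewrite full; apply: eq_bigr => u _; by rewrite fuelE.
  apply: leq_trans; rewrite card_dominated big_mkord; apply: leq_sum => i _.
  rewrite gain_encode; apply: subset_leq_card; apply/subsetP => v.
  rewrite !inE => /existsP[u /andP[au vu]]; apply/existsP; exists u.
  rewrite vu andbT digit_enc // => [|w]; last exact: aK.
  by rewrite actE enum_rankK greedy_covers.
move=> tv.
have [F [es]] := @value_path inp n K.+1 l.+1 T (ltn0Sn K) T _ (leqnn T) fB.
rewrite subnn => -[F0 path VE].
have FB i : i <= T -> F i < K.+1 ^ n.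
  elim: i => [|i IH] iT; first by rewrite F0.
  have [_ _ ->] := path i iT.
  exact: leq_ltn_trans (leq_subr _ _) (IH (ltnW iT)).
pose fuel (v : V) i := digit K.+1 (F i) (enum_rank v).
pose act (v : V) i := digit K.+1 (es i) (enum_rank v) != 0.
have [||S tl cov] := @timeline_of_runs V T k l.+1 fuel act (ltn0Sn l).
- move=> v i iT; rewrite /fuel /act; have [lg le FS] := path i iT.
  have vn := ltn_ord (enum_rank v).
  have /legalP lgP := lg; have [d1 df d0] := lgP _ vn.
  split.
  + by rewrite -lt0n => h; apply: leq_trans df.
  + by rewrite negbK => /eqP /d0.
  (* Legality bounds the digits of [es i] by those of [F i], so every vertex loses exactly its own
     digit of fuel, and that digit, being at most 1, is the Boolean [act v i]. *)
  + rewrite FS (@digit_sub _ n) //.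
    * by congr (_ - _); case: (digit _ (es i) _) d1 => [|[]].
    * exact: FB (ltnW iT).
    * exact: leq_ltn_trans le (FB _ (ltnW iT)).
    * by move=> w wn; have [] := lgP w wn.
- by move=> v; rewrite /fuel F0 full digit_enc.
apply/existsP; exists S; rewrite tl /=; apply: leq_trans tv _.
rewrite VE card_dominated big_mkord; apply: leq_sum => i _.
rewrite gain_encode; apply: subset_leq_card; apply/subsetP => v.
rewrite !inE => /existsP[u /andP[au vu]]; apply/existsP; exists u.
by rewrite vu andbT; apply: cov.
Qed.

End Encoding.

Theorem theorem5p5 :
  exists (P : program) (c : nat),
    forall (V : finType) (T : nat) (G : temporal_graph V T) (k l t : nat),
      1 <= k ->
      answers_within P (encode G k l t)
        (c * 2 ^ (c * t) * (#|V| + T + 1) ^ c)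
        (timeline_partial_dominating_set G k l t).
Proof.
have [A HA] := cost_main_code.
pose code := compile main_code 0 0.
exists (code ++ [:: Jumpz (3 * vout) (size code + 2); Accept; Reject]).
(* The factor 2 in [cost_main_code] contributes 2^A, the closing test and halt contribute 2, and the
   square of n + T + 1 in the cap gives the exponent 2 A. *)
exists (A * 2 ^ A + 2 + 2 * A) => V T G k l t k0.
have e0 : nth 0 (encode G k l t) 0 = #|V| by [].
have e1 : nth 0 (encode G k l t) 1 = T by [].
have e2 : nth 0 (encode G k l t) 2 = k by [].
have e3 : nth 0 (encode G k l t) 3 = l by [].
have e4 : nth 0 (encode G k l t) 4 = t by [].
have := main_code_correct (encode G k l t); cbv zeta.
have := HA (encode G k l t); rewrite e0 e1 e2 e3 e4.
set N := #|V| + T + 1 => cost_le [yes no dp].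
set fuel := _ * _ * _.
have fuel_le : cost (encode G k l t) main_code init + 2 <= fuel.
  have N1 : 1 <= N by rewrite /N addn1.
  set c := A * 2 ^ A + 2 + 2 * A in fuel *.
  set X := 2 ^ (A * t) * N ^ (2 * A).
  have X1 : 0 < X by rewrite muln_gt0 !expn_gt0 N1.
  have XE : A * (2 * (N ^ 2 * 2 ^ t)) ^ A = A * 2 ^ A * X.
    rewrite (expnMn 2) (expnMn (N ^ 2)) -(expnM N) -(expnM 2) (mulnC t A) /X.
    by rewrite -(mulnA A) (mulnC (N ^ _)).
  apply: leq_trans (_ : (A * 2 ^ A + 2) * X <= _).
    by rewrite mulnDl leq_add // -?XE // leq_pmulr.
  rewrite /fuel -mulnA; apply: leq_mul; first by rewrite /c; lia.
  apply: leq_mul; first by rewrite leq_exp2l // leq_mul2r /c; lia.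
  by rewrite leq_pexp2l // /c; lia.
have := exec_compile vout fuel_le; rewrite -/code -/init.
suff -> : timeline_partial_dominating_set G k l t =
  (var (sem (encode G k l t) main_code init) vout != 0) by [].
case: (leqP t (#|V| * minn (minn k T * (minn l T).+1) T)) => [tq|qt].
  rewrite yes //; apply: (@saturated_yes V T G k l t (minn l T).+1) => //.
  by rewrite ltnS geq_minl.
case: (leqP t (#|V| * T)) => [tn|nt]; last first.
  rewrite no //; apply/negbTE/existsPn => S; rewrite negb_and -ltnNge.
  by rewrite (leq_ltn_trans (dominated_le G S) nt) orbT.
rewrite dp //.
(* In the remaining case the product is below T. As k >= 1, this forces k and l themselves below T,
   so the clamped parameters used by the program are the true ones. *)
have KT : minn k T * (minn l T).+1 < T.
  by rewrite ltnNge; apply/negP => h; move: qt; rewrite (minn_idPr h) ltnNge tn.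
have kT : minn k T = k.
  apply/minn_idPl; rewrite leqNgt; apply/negP => Tk; move: KT.
  by rewrite (minn_idPr (ltnW Tk)) ltnNge leq_pmulr.
have lT : minn l T = l.
  apply/minn_idPl; rewrite leqNgt; apply/negP => Tl; move: KT.
  by rewrite kT (minn_idPr (ltnW Tl)) ltnNge (leq_trans (leqnSn T)) //
    leq_pmull.
by rewrite value_timeline kT lT.
Qed.
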